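(* Assume that $\mathrm S$ and $\mathbb U$ are compact. Then the value function $V$, defined for $P\in\mathcal P(\mathcal P(\mathbb X)\times\mathcal P(\mathbb X))$ and $\underline U\in\mathbb U^T$ by $$V(P,\underline U):=\int_{\mathcal P(\mathbb X)\times\mathcal P(\mathbb X)}W_{2,\lambda}(\Phi_T(\mu,\underline U),\nu)^2\,P(d\mu,d\nu),$$ is jointly continuous on $\mathcal P(\mathcal P(\mathbb X)\times\mathcal P(\mathbb X))\times\mathbb U^T$.
   Context: Fix integers $N,d,d_1,d_2,T\ge1$, $\beta>0$, $\lambda>0$. Let $\emptyset\ne\mathrm S\subset\mathbb R^d$, $\mathrm{PE}_N:=\{i/N:i=1,\dots,N\}$, $\mathbb X:=\mathrm{PE}_N\times\mathrm S$. Let $\sigma:\mathbb R^{d_1}\to\mathbb R^{d_1}$ be $1$-Lipschitz. The action space $\mathbb U$ is a nonempty subset of $\mathbb R^{d\times d_1}\times\mathbb R^{d_1\times d}\times\mathbb R^{d_1}\times\mathbb R^{d_2\times d}\times\mathbb R^{d_2\times d}\times\mathbb R^{d\times d}$ with the Euclidean (product Frobenius) norm; its elements are written $U=(\mathsf W,\mathsf A,\mathsf b,\mathsf Q,\mathsf K,\mathsf V)$. $\mathcal P(\Omega)$ denotes the Borel probability measures on $\Omega$, with the topology of weak convergence (convergence against bounded continuous functions); $\mathcal P(\mathbb X)\times\mathcal P(\mathbb X)$ carries the product topology, and $\mathcal P(\mathcal P(\mathbb X)\times\mathcal P(\mathbb X))$ the corresponding weak convergence topology. For $\mu\in\mathcal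 P(\mathbb X)$, $\mu_{\mathrm S}$ is its marginal on $\mathrm S$. Define $f:\mathbb X\times\mathbb U\times\mathcal P(\mathbb X)\to\mathbb X$ by $$f((p,x),U,\mu):=\Big(p,\ \mathsf W\sigma(\mathsf Ax+\mathsf b)+\frac{\int_{\mathrm S}e^{\beta\langle\mathsf Qx,\mathsf Kz\rangle}\mathsf Vz\,\mu_{\mathrm S}(dz)}{\int_{\mathrm S}e^{\beta\langle\mathsf Qx,\mathsf Kz\rangle}\mu_{\mathrm S}(dz)}\Big);$$ it is a standing convention that $f$ is $\mathbb X$-valued. Let $\Phi(\mu,U):=\mu\circ f(\cdot,U,\mu)^{-1}$ (push-forward). For $\underline U=(U_0,\dots,U_{T-1})\in\mathbb U^T$ let $\Phi_T(\mu,\underline U)$ be the terminal measure $\mu_T$ of the recursion $\mu_0=\mu$, $\mu_{t+1}=\Phi(\mu_t,U_t)$, $t=0,\dots,T-1$. $W_{2,\lambda}(P,Q):=\big(\inf_\pi\int(\|x-y\|_2^2+\lambda|p-q|^2)\,\pi(d(p,x),d(q,y))\big)^{1/2}$ over couplings $\pi$ of $P,Q\in\mathcal P(\mathbb X)$. *)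

(* Defs.v *)
From HB Require Import structures.
From mathcomp Require Import all_boot all_order all_algebra.
From mathcomp Require Import all_classical all_reals all_analysis.
From mathcomp Require Import measurable_realfun.

Set Implicit Arguments.
Unset Strict Implicit.
Unset Printing Implicit Defensive.

Import Order.TTheory GRing.Theory Num.Theory.
Import numFieldNormedType.Exports.

Local Open Scope classical_set_scope.
Local Open Scope ring_scope.

HB.instance Definition _ (T U : ptopologicalType) := Pointed.on (T * U)%type.

(* A nonempty subset [A] with its subspace topology. [set_type A] has the
   topology but no distinguished point, which measurable types require. *)
Definition nset {T : Type} (A : set T) (A0 : A !=set0) : Type := set_type A.

HB.instance Definition _ (T : choiceType) (A : set T) (A0 : A !=set0) :=
  Choice.copy (nset A0) (set_type A).
HB.instance Definition _ (T : choiceType) (A : set T) (A0 : A !=set0) :=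
  isPointed.Build (nset A0) (exist _ (projT1 (cid A0)) (mem_set (projT2 (cid A0)))).
HB.instance Definition _ (T : topologicalType) (A : set T) (A0 : A !=set0) :=
  Topological.copy (nset A0) (set_type A).

Definition nval {T : Type} {A : set T} {A0 : A !=set0} (x : nset A0) : T :=
  set_val x.

Definition nset_of {T : Type} {A : set T} (A0 : A !=set0) {x : T} (Ax : A x) :
    nset A0 :=
  exist _ x (mem_set Ax).

Definition borel (T : ptopologicalType) := g_sigma_algebraType (@open T).

HB.instance Definition _ (T : ptopologicalType) := Measurable.on (borel T).

(* Elements are determined only through their values on Borel sets: as set
   functions, they may differ on the other sets. The topology below does not
   distinguish such elements. *)
Definition bprob (R : realType) (T : ptopologicalType) : Type :=
  probability (borel T) R.

Identity Coercion probability_of_bprob : bprob >-> probability.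

Definition bcont (R : realType) (T : topologicalType) : Type :=
  {h : T -> R | continuous h /\ [bounded h x | x in [set: T]]}.

Definition bcont_integral (R : realType) (T : ptopologicalType)
    (mu : bprob R T) : {ptws bcont R T -> R} :=
  fun h => \int[mu]_x (sval h x).

HB.instance Definition _ (R : realType) (T : ptopologicalType) :=
  Pointed.copy (bprob R T) (probability (borel T) R).
HB.instance Definition _ (R : realType) (T : ptopologicalType) :=
  Topological.copy (bprob R T) (initial_topology (@bcont_integral R T)).

Section borel_measurability.
Variable R : realType.

Lemma continuous_borel_measurable (T : ptopologicalType) (h : T -> R) :
  continuous h -> measurable_fun [set: borel T] (h : borel T -> R).
Proof.
move=> /continuousP ch; apply: (measurability _ (RGenOpens.measurableE R)).
move=> _ [_ [a [b ->]] <-]; rewrite setTI.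
by apply: sub_sigma_algebra; apply: ch; exact: interval_open.
Qed.

Lemma continuous_borel_measurable2 (T T' : ptopologicalType) (h : T -> T') :
  continuous h -> measurable_fun [set: borel T] (h : borel T -> borel T').
Proof.
move=> /continuousP ch; apply: (@measurability _ _ (borel T) (borel T') setT h (@open T') erefl).
by move=> _ [A oA <-]; rewrite setTI; apply: sub_sigma_algebra; exact: ch.
Qed.

Lemma nval_continuous (T : ptopologicalType) (A : set T) (A0 : A !=set0) :
  continuous (@nval T A A0).
Proof. exact: initial_continuous. Qed.

Lemma nval_coord_continuous d (S : set 'cV[R]_d) (S0 : S !=set0) (i : 'I_d) :
  continuous (fun x : nset S0 => nval x i 0 : R).
Proof.
move=> x; apply: (@continuous_comp _ _ _ (@nval _ _ S0)
  (fun M : 'cV[R]_d => M i 0)); first exact: nval_continuous.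
exact: coord_continuous.
Qed.

Lemma countable_base_borel_measurable disp (Om : measurableType disp)
    (T : ptopologicalType) (K : countType) (B : K -> set T) (g : Om -> T) :
  (forall Z x, open Z -> Z x -> exists2 k, B k x & B k `<=` Z) ->
  (forall k, measurable (g @^-1` B k)) ->
  measurable_fun [set: Om] (g : Om -> borel T).
Proof.
move=> Bbase mB; apply: (@measurability _ _ Om (borel T) setT g (@open T) erefl).
move=> _ [Z oZ <-]; rewrite setTI.
have -> : g @^-1` Z =
    \bigcup_k (if `[< B k `<=` Z >] then g @^-1` B k else set0).
  apply/seteqP; split=> w /=.
    move=> /(Bbase _ _ oZ)[k Bk kZ]; exists k => //.
    by case: asboolP.
  move=> [k _]; case: asboolP => // kZ; exact: kZ.
apply: countable_bigcupT_measurable => // k.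
by case: asboolP => // _; exact: measurable0.
Qed.

Lemma coord_measurable_nset disp (Om : measurableType disp) d
    (E : set R) (E0 : E !=set0) (S : set 'cV[R]_d) (S0 : S !=set0)
    (g : Om -> nset E0 * nset S0) :
  measurable_fun setT (fun w => nval (g w).1 : R) ->
  (forall i, measurable_fun setT (fun w => nval (g w).2 i 0 : R)) ->
  measurable_fun [set: Om] (g : Om -> borel (nset E0 * nset S0)%type).
Proof.
move=> m1 m2.
pose B (k : rat * 'cV[rat]_d * rat) : set (nset E0 * nset S0) :=
  [set y : (nset E0 * nset S0)%type |
     `|nval y.1 - ratr k.1.1| < ratr k.2 /\
     forall i, `|nval y.2 i 0 - ratr (k.1.2 i 0)| < ratr k.2].
apply: (@countable_base_borel_measurable _ Om
  (nset E0 * nset S0)%type _ B g).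
- move=> Z y oZ Zy.
  have : nbhs y Z by apply: open_nbhs_nbhs.
  case=> -[U1 U2] /= [[W1 [[V1 oV1 V1W1] W1y] W1U1] [W2 [[V2 oV2 V2W2] W2y] W2U2]] UZ.
  have nV1 : nbhs (nval y.1) V1.
    by apply: open_nbhs_nbhs; split=> //; move: W1y; rewrite -V1W1.
  have nV2 : nbhs (nval y.2) V2.
    by apply: open_nbhs_nbhs; split=> //; move: W2y; rewrite -V2W2.
  move/nbhs_ballP : nV1 => [e1 /= e10 eV1].
  move/nbhs_ballP : nV2 => [e2 /= e20 eV2].
  pose e := Num.min e1 e2.
  have e0 : 0 < e / 2 by rewrite divr_gt0// lt_min e10.
  have [r] := rat_in_itvoo e0.
  rewrite in_itv/= => /andP[r0 re].
  have near_rat (a : R) : exists q : rat, `|a - ratr q| < ratr r.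
    have [|q] := @rat_in_itvoo _ (a - ratr r) (a + ratr r).
      by rewrite ltrD2l (lt_trans _ r0)// oppr_lt0.
    rewrite in_itv/= => aq; exists q.
    by rewrite distrC ltr_distl.
  have [q yq] := near_rat (nval y.1).
  have [c yc] := choice (fun i : 'I_d => near_rat (nval y.2 i 0)).
  exists (q, \col_i c i, r).
    by split => //= i; rewrite mxE.
  have close (a b s : R) : `|a - s| < ratr r -> `|b - s| < ratr r ->
      `|a - b| < e.
    move=> ar br; rewrite (le_lt_trans (ler_distD s _ _))// (distrC s).
    rewrite (lt_le_trans (ltrD ar br))// -mulr2n -mulr_natr.
    by rewrite -ler_pdivlMr// ltW.
  move=> z [/= zq zc]; apply: UZ; split=> /=.
    apply: W1U1; rewrite -V1W1; apply: eV1.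
    rewrite /ball/=; apply: (lt_le_trans (close _ _ _ yq zq)).
    by rewrite ge_min lexx.
  apply: W2U2; rewrite -V2W2; apply: eV2; split=> // i j.
  rewrite (ord1 j); apply: (lt_le_trans (close _ _ _ (yc i) _)).
    by have := zc i; rewrite mxE.
  by rewrite ge_min lexx orbT.
- move=> k.
  have lt_meas (h : Om -> R) (a s : R) : measurable_fun setT h ->
      measurable [set w | `|h w - a| < s].
    move=> mh.
    have -> : [set w | `|h w - a| < s] = setT `&` h @^-1` ball a s.
      by rewrite setTI; apply/seteqP; split=> w /=; rewrite /ball/= distrC.
    by apply: mh => //; rewrite ball_itv; exact: measurable_itv.
  have -> : g @^-1` B k =
      [set w | `|nval (g w).1 - ratr k.1.1| < ratr k.2] `&`
      \bigcap_(i in [set: 'I_d])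
        [set w | `|nval (g w).2 i 0 - ratr (k.1.2 i 0)| < ratr k.2].
    apply/seteqP; split=> w /=.
      by move=> [? h]; split=> // i _; exact: h.
    by move=> [? h]; split=> // i; exact: h.
  apply: measurableI; first exact: lt_meas.
  by apply: fin_bigcap_measurable => // i _; exact: lt_meas.
Qed.

Lemma inv_measurable : measurable_fun [set: R] (@GRing.inv R).
Proof.
rewrite -(setUv [set (0 : R)]); apply/measurable_funU => //.
  exact: measurableC.
split; first exact: measurable_fun_set1.
apply: open_continuous_measurable_fun; first exact: closed_openC.
by move=> x; rewrite inE/= => /eqP x0; exact: inv_continuous.
Qed.

Lemma Rintegral_measurable d1 d2 (T1 : measurableType d1)
    (T2 : measurableType d2) (m : probability T2 R) (h : T1 -> T2 -> R) :
  measurable_fun [set: T1 * T2] (fun z => h z.1 z.2) ->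
  measurable_fun [set: T1] (fun x => \int[m]_y h x y).
Proof.
move=> mh; apply: (measurableT_comp (fine_measurable measurableT)).
under eq_fun do rewrite integralE.
have meh : measurable_fun [set: T1 * T2] (fun z => (h z.1 z.2)%:E).
  exact/measurable_EFinP.
apply: emeasurable_funB.
  have := @measurable_fun_fubini_tonelli_F _ _ _ _ _ m _
    (measurable_funepos meh) (fun=> funepos_ge0 _ _).
  congr measurable_fun; apply: funext => x; rewrite /fubini_F.
  by apply: eq_integral => y _; rewrite unlock.
have := @measurable_fun_fubini_tonelli_F _ _ _ _ _ m _
  (measurable_funeneg meh) (fun=> funeneg_ge0 _ _).
congr measurable_fun; apply: funext => x; rewrite /fubini_F.
by apply: eq_integral => y _; rewrite unlock.
Qed.

End borel_measurability.

Definition pushforward_prob (R : realType) (T T' : ptopologicalType) (g : T -> T')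
    (mg : measurable_fun [set: borel T] (g : borel T -> borel T'))
    (mu : bprob R T) : bprob R T' :=
  distribution (mu : probability (borel T) R)
    (mfun_Sub (mem_set mg) : {mfun borel T >-> borel T'}).

Lemma pushforward_probE (R : realType) (T T' : ptopologicalType) (g : T -> T')
    (mg : measurable_fun [set: borel T] (g : borel T -> borel T'))
    (mu : bprob R T) (B : set T') :
  pushforward_prob mg mu B = mu (g @^-1` B).
Proof. by []. Qed.

Definition dotv (R : realType) n (x y : 'cV[R]_n) : R :=
  \sum_(i < n) x i 0 * y i 0.

Definition l2norm (R : realType) n (x : 'cV[R]_n) : R := Num.sqrt (dotv x x).

Lemma coord_le_l2norm (R : realType) n (x : 'cV[R]_n) (j : 'I_n) :
  `|x j 0| <= l2norm x.
Proof.
rewrite -sqrtr_sqr /l2norm ler_wsqrtr// /dotv (bigD1 j)//= -expr2 lerDl.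
by apply: sumr_ge0 => i _; rewrite -expr2 sqr_ge0.
Qed.

Lemma continuous_dotv (R : realType) (T : topologicalType) n (x y : T -> 'cV[R]_n) :
  (forall i, continuous (fun t => x t i 0)) ->
  (forall i, continuous (fun t => y t i 0)) ->
  continuous (fun t => dotv (x t) (y t)).
Proof.
move=> cx cy; rewrite /dotv.
apply: continuous_big => [|i _ t]; first exact: add_continuous.
by apply: cvgM; [exact: cx|exact: cy].
Qed.

Lemma continuous_mulmx_coord (R : realType) (T : topologicalType) m n
    (A : 'M[R]_(m, n)) (x : T -> 'cV[R]_n) :
  (forall i, continuous (fun t => x t i 0)) ->
  forall j, continuous (fun t => (A *m x t) j 0).
Proof.
move=> cx j; have -> : (fun t => (A *m x t) j 0) =
    (fun t => dotv (\col_i A j i) (x t)).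
  by apply: funext => t; rewrite mxE; apply: eq_bigr => i _; rewrite mxE.
by apply: continuous_dotv => // i t; exact: cvg_cst.
Qed.

Lemma lipschitz_coord_continuous (R : realType) (T : topologicalType) m n
    (s : 'cV[R]_m -> 'cV[R]_n) (x : T -> 'cV[R]_m) :
  (forall u v, l2norm (s u - s v) <= l2norm (u - v)) ->
  (forall i, continuous (fun t => x t i 0)) ->
  forall j, continuous (fun t => s (x t) j 0).
Proof.
move=> lip cx j t.
have c : continuous (fun t' => l2norm (x t' - x t)).
  have cB i : continuous (fun t' => (x t' - x t) i 0).
    move=> t'; have -> : (fun t' => (x t' - x t) i 0) =
        (fun t' => x t' i 0 - x t i 0) by apply: funext => ?; rewrite !mxE.
    by apply: cvgB; [exact: cx|exact: cvg_cst].
  move=> t'; apply: (@continuous_comp _ _ _ (fun t' => dotv (x t' - x t)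
    (x t' - x t)) (@Num.sqrt R)); last exact: sqrt_continuous.
  exact: continuous_dotv.
have l0 : l2norm (x t - x t) = 0.
  by rewrite subrr /l2norm /dotv big1 ?sqrtr0// => i _; rewrite mxE mul0r.
apply/cvgrPdist_lt => e e0.
have /cvgrPdist_lt/(_ _ e0) := c t.
rewrite l0; apply: filterS => t'; rewrite sub0r normrN => h.
have := coord_le_l2norm (s (x t) - s (x t')) j; rewrite !mxE => h'.
apply: (le_lt_trans h'); apply: le_lt_trans h.
rewrite (le_trans (lip _ _))//.
rewrite -opprB /l2norm /dotv.
under eq_bigr do rewrite mxE mulrNN.
by rewrite ger0_norm// sqrtr_ge0.
Qed.

Definition PE (R : realType) (N : nat) : set R :=
  [set p | exists2 i : nat, (1 <= i <= N)%N & p = i%:R / N%:R].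
Arguments PE : clear implicits.

Lemma PE_nonempty (R : realType) (N : nat) : (0 < N)%N -> PE R N !=set0.
Proof. by move=> N0; exists (1%:R / N%:R); exists 1%N. Qed.
Arguments PE_nonempty R {N}.

(* The parameter (W, A, b, Q, K, V); its product topology is that of the
   Euclidean norm. *)
Definition param (R : realType) (d d1 d2 : nat) : Type :=
  ('M[R]_(d, d1) * 'M[R]_(d1, d) * 'cV[R]_d1 *
   'M[R]_(d2, d) * 'M[R]_(d2, d) * 'M[R]_(d, d))%type.

HB.instance Definition _ R d d1 d2 := Topological.on (param R d d1 d2).

Section model.
Variables (R : realType) (N d d1 d2 : nat) (N0 : (0 < N)%N) (beta lambda : R).
Variables (S : set 'cV[R]_d) (S0 : S !=set0).
Variables (sigma : 'cV[R]_d1 -> 'cV[R]_d1) (UU : set (param R d d1 d2)).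

Definition state : ptopologicalType :=
  (nset (PE_nonempty R N0) * nset S0)%type.

Lemma measurable_snd_state :
  measurable_fun [set: borel state] (snd : borel state -> borel (nset S0)).
Proof. by apply: continuous_borel_measurable2 => x; exact: cvg_snd. Qed.

Definition marginalS (mu : bprob R state) : bprob R (nset S0) :=
  pushforward_prob measurable_snd_state mu.

(* Coordinatewise integrals; the integrands are bounded when [S] is bounded. *)
Definition attention (Q K : 'M[R]_(d2, d)) (V : 'M[R]_(d, d))
    (x : 'cV[R]_d) (m : bprob R (nset S0)) : 'cV[R]_d :=
  let w (z : nset S0) := expR (beta * dotv (Q *m x) (K *m nval z)) in
  (\int[m]_z w z)^-1 *:
    \col_(i < d) \int[m]_z (w z * (V *m nval (z : nset S0)) i 0).

Definition token_map (x : 'cV[R]_d) (U : param R d d1 d2)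
    (m : bprob R (nset S0)) : 'cV[R]_d :=
  let: (W, A, b, Q, K, V) := U in
  W *m sigma (A *m x + b) + attention Q K V x m.

(* The map (p, x) |-> (p, token_map x U mu_S) is [state]-valued. *)
Definition token_map_stable : Prop :=
  forall (x : 'cV[R]_d) U (mu : bprob R state), S x -> UU U ->
    S (token_map x U (marginalS mu)).

Hypothesis sigma_lip : forall x y, l2norm (sigma x - sigma y) <= l2norm (x - y).
Hypothesis fX : token_map_stable.

Definition transition (px : state) (U : set_type UU) (mu : bprob R state) :
    state :=
  (px.1, nset_of S0 (fX mu (set_valP px.2) (set_valP U))).

Lemma transition_measurable (U : set_type UU) (mu : bprob R state) :
  measurable_fun [set: borel state]
    ((fun px => transition px U mu) : borel state -> borel state).
Proof.
pose M (px : state) := nval px.2.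
have cM i : continuous (fun px : state => M px i 0).
  move=> px; apply: (@continuous_comp _ _ _ (@snd _ _)
    (fun x : nset S0 => nval x i 0)); first exact: cvg_snd.
  exact: nval_coord_continuous.
apply: (@coord_measurable_nset R _ (borel state) d _ (PE_nonempty R N0) S S0
  (fun px => transition px U mu)).
  apply: (@continuous_borel_measurable R state (fun px => nval px.1)) => px.
  apply: (@continuous_comp _ _ _ (@fst _ _) (@nval _ _ (PE_nonempty R N0))).
    exact: cvg_fst.
  exact: nval_continuous.
move=> i.
have [W [A [b [Q [K [V UE]]]]]] : exists W A b Q K V,
    set_val U = (W, A, b, Q, K, V) :> param R d d1 d2.
  by case: (set_val U) => -[] [] [] [] W A b Q K V; exists W, A, b, Q, K, V.
set m := marginalS mu.
have mM j : measurable_fun [set: borel state] (fun px : state => M px j 0).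
  exact: continuous_borel_measurable.
pose w (px : state) (z : nset S0) :=
  expR (beta * dotv (Q *m M px) (K *m nval z)).
have mcoord1 k (B : 'M[R]_(k, d)) j : measurable_fun
    [set: borel state * borel (nset S0)] (fun z => (B *m M z.1) j 0).
  under eq_fun do rewrite mxE.
  apply: measurable_sum => l; apply: measurable_funM => //.
  exact: (measurableT_comp (mM l)).
have mcoord2 k (B : 'M[R]_(k, d)) j : measurable_fun
    [set: borel state * borel (nset S0)]
    (fun z => (B *m nval (z.2 : nset S0)) j 0).
  under eq_fun do rewrite mxE.
  apply: measurable_sum => l; apply: measurable_funM => //.
  apply: (@measurableT_comp _ _ _ _ (borel (nset S0)) _
    (fun z : nset S0 => nval z l 0)) => //.
  by apply: continuous_borel_measurable; exact: nval_coord_continuous.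
have mw : measurable_fun [set: borel state * borel (nset S0)]
    (fun z => w z.1 z.2).
  apply: (measurableT_comp (@measurable_expR R)).
  apply: measurable_funM => //; apply: measurable_sum => l.
  by apply: measurable_funM; [exact: mcoord1|exact: mcoord2].
have -> : (fun px : borel state => nval (transition px U mu).2 i 0) =
    (fun px => (W *m sigma (A *m M px + b)) i 0 +
      (\int[m]_z w px z)^-1 * \int[m]_z (w px z * (V *m nval (z : nset S0)) i 0)).
  apply: funext => px.
  have -> : nval (transition px U mu).2 = token_map (nval px.2) (set_val U) m.
    by [].
  by rewrite UE /token_map/attention mxE [X in _ + X]mxE [X in _ * X]mxE.
apply: measurable_funD.
  apply: (@continuous_borel_measurable R state
    (fun px => (W *m sigma (A *m M px + b)) i 0)).
  apply: continuous_mulmx_coord => j.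
  apply: (lipschitz_coord_continuous (x := fun px => A *m M px + b)) => // l px.
  have -> : (fun px => (A *m M px + b) l 0) =
      (fun px => (A *m M px) l 0 + b l 0) by apply: funext => ?; rewrite mxE.
  by apply: cvgD; [exact: continuous_mulmx_coord|exact: cvg_cst].
apply: measurable_funM.
  have := @Rintegral_measurable R _ _ (borel state) (borel (nset S0)) m w mw.
  exact: (measurableT_comp (@inv_measurable R)).
apply: (@Rintegral_measurable R _ _ (borel state) (borel (nset S0)) m
  (fun px z => w px z * (V *m nval (z : nset S0)) i 0)).
by apply: measurable_funM.
Qed.

Definition step (mu : bprob R state) (U : set_type UU) : bprob R state :=
  pushforward_prob (transition_measurable U mu) mu.

Definition flow (T : nat) (mu : bprob R state)
    (u : {ptws 'I_T -> set_type UU}) : bprob R state :=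
  foldl step mu [seq u t | t <- enum 'I_T].

Definition cost (a b : state) : R :=
  l2norm (nval a.2 - nval b.2) ^+ 2 + lambda * `|nval a.1 - nval b.1| ^+ 2.

Definition coupling (P Q : bprob R state) :
    set (bprob R (state * state)%type) :=
  [set pi | forall B : set (borel state), measurable B ->
     pi (fst @^-1` B) = P B /\ pi (snd @^-1` B) = Q B].

Definition W2 (P Q : bprob R state) : \bar R :=
  sqrte (ereal_inf [set (\int[pi]_z (cost z.1 z.2)%:E)%E | pi in coupling P Q]).

Definition value (T : nat)
    (P : bprob R (bprob R state * bprob R state)%type)
    (u : {ptws 'I_T -> set_type UU}) : \bar R :=
  (\int[P]_z (W2 (flow z.1 u) z.2) ^+ 2)%E.

End model.

(* Main.v *)
(* The cost [W2 ^ 2] of [P], [P'] against the same [Q] differs little as soon as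
   finitely many continuous test functions, a partition of unity subordinate to
   small balls, have nearly the same means under [P] and [P']: a coupling of [P]
   and [Q] is turned into one of [P'] and [Q] by resampling the first coordinate
   within the cells of the partition. This estimate is uniform in [P], [P'] and
   [Q], so neither compactness of the space of probability measures nor gluing of
   couplings is needed.

   All continuity statements are phrased for two families of measures indexed by
   a filter whose integrals of every bounded continuous function become close. One
   step of the dynamics preserves this relation while the parameter converges.
   Taking the filter of neighborhoods of a parameter, uniformly in the pair of
   measures, gives uniform convergence of the integrand of [V] in the parameter;
   taking the neighborhoods of a pair of measures gives its continuity for a fixed
   parameter. The two together give joint continuity of [V]. *)
Require Import Defs.
From HB Require Import structures.
From mathcomp Require Import all_boot all_order all_algebra.
From mathcomp Require Import all_classical all_reals all_analysis.
From mathcomp Require Import measurable_realfun ring lra.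

Set Implicit Arguments.
Unset Strict Implicit.
Unset Printing Implicit Defensive.

Import Order.TTheory GRing.Theory Num.Theory.
Import numFieldNormedType.Exports.
Import HBNNSimple.

Local Open Scope classical_set_scope.
Local Open Scope ring_scope.

(** * Densities *)

Section density_image.
Local Open Scope ereal_scope.
Context d d' (Om : measurableType d) (T : measurableType d') (R : realType).
Variables (m : {measure set Om -> \bar R}) (g : Om -> R) (tau : Om -> T).
Hypotheses (mg : measurable_fun setT g) (g0 : forall w, (0 <= g w)%R).
Hypotheses (mtau : measurable_fun setT tau) (g1 : \int[m]_w (g w)%:E = 1).

Let pre B : measurable B -> measurable (tau @^-1` B).
Proof. by move=> mB; rewrite -[X in measurable X]setTI; exact: mtau. Qed.

(** The measure with density [g] with respect to [m], transported by [tau]. In [couplings_reweight],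
    [m] is a product measure on triples and [tau] forgets one coordinate. *)
Definition density_image (B : set T) := \int[m]_(w in tau @^-1` B) (g w)%:E.

Let density_image0 : density_image set0 = 0.
Proof. by rewrite /density_image preimage_set0 integral_set0. Qed.

Let density_image_ge0 B : 0 <= density_image B.
Proof. by apply: integral_ge0 => *; rewrite lee_fin. Qed.

Let density_image_additive : semi_sigma_additive density_image.
Proof.
move=> F mF tF mUF.
rewrite [X in _ --> X](_ : _ = \sum_(i <oo) density_image (F i)).
  by apply: is_cvg_ereal_nneg_natsum => n _; exact: density_image_ge0.
rewrite /density_image preimage_bigcup ge0_integral_bigcup//.
- by move=> k; exact: pre.
- by apply: measurable_funTS; exact/measurable_EFinP.
- by move=> *; rewrite lee_fin.
- apply/trivIsetP => i j _ _ ij; rewrite -preimage_setI.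
  by move/trivIsetP : tF => ->//; rewrite preimage_set0.
Qed.

HB.instance Definition _ := isMeasure.Build _ _ _ density_image
  density_image0 density_image_ge0 density_image_additive.

Let density_imageT : density_image setT = 1.
Proof. by rewrite /density_image preimage_setT. Qed.

HB.instance Definition _ :=
  Measure_isProbability.Build _ _ _ density_image density_imageT.

Definition density_image_prob : probability T R := density_image.

(** A simple function is a finite combination of indicators of its level sets; for an indicator both
    sides reduce to the defining integral of [density_image]. *)
Let integral_density_image_nnsfun (h : {nnsfun T >-> R}) :
  \int[density_image_prob]_y (h y)%:E = \int[m]_w ((h (tau w))%:E * (g w)%:E).
Proof.
have mr r : measurable (h @^-1` [set r]) by exact: measurable_sfunP.
transitivity (\int[density_image_prob]_y
   (\sum_(r \in range h) (r * \1_(h @^-1` [set r]) y)%:E)).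
  by apply: eq_integral => t _; rewrite /= fimfunE -fsumEFin.
rewrite ge0_integral_fsum//; last 2 first.
- by move=> r; exact/measurable_EFinP/measurable_funM.
- by move=> r y _; exact: nnfun_muleindic_ge0.
transitivity (\int[m]_w (\sum_(r \in range h)
    ((r * \1_(h @^-1` [set r]) (tau w))%:E * (g w)%:E))); last first.
  apply: eq_integral => w _.
  rewrite -ge0_mule_fsuml => [|r]; last exact: nnfun_muleindic_ge0.
  by rewrite fsumEFin// -fimfunE.
have mi r : measurable_fun setT
    (fun w => (r * \1_(h @^-1` [set r]) (tau w))%:E).
  apply/measurable_EFinP; apply: measurable_funM => //.
  by apply: measurableT_comp.
rewrite ge0_integral_fsum//; last 2 first.
- by move=> r; apply: emeasurable_funM; [exact: mi|exact/measurable_EFinP].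
- by move=> r w _; rewrite mule_ge0 ?lee_fin// -lee_fin nnfun_muleindic_ge0.
apply: eq_fsbigr => r rh.
have r0 : (0 <= r)%R by move: rh; rewrite inE => -[y _ <-].
under eq_integral do rewrite EFinM.
rewrite ge0_integralZl//; last exact/measurable_EFinP.
rewrite integral_indic// setIT.
under [RHS]eq_integral do rewrite EFinM -muleA.
rewrite ge0_integralZl//; last 2 first.
- apply: emeasurable_funM; apply/measurable_EFinP => //.
  exact: measurableT_comp.
- by move=> w _; rewrite mule_ge0 ?lee_fin.
congr (_ * _); rewrite /= /density_image integral_mkcond.
apply: eq_integral => w _; rewrite /= patchE indicE.
have -> : (tau w \in h @^-1` [set r]) = (w \in tau @^-1` (h @^-1` [set r])).
  by apply/idP/idP; rewrite !inE.
by case: ifPn => _; rewrite ?mul1e ?mul0e.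
Qed.

(** Monotone convergence on both sides, along simple functions increasing to [h]. *)
Lemma integral_density_image (h : T -> \bar R) :
  measurable_fun setT h -> (forall y, 0 <= h y) ->
  \int[density_image_prob]_y h y = \int[m]_w (h (tau w) * (g w)%:E).
Proof.
move=> mh h0; pose f := nnsfun_approx measurableT mh.
transitivity (limn (fun n => \int[density_image_prob]_y (f n y)%:E)).
  rewrite -monotone_convergence//.
  - apply: eq_integral => y _; apply/esym/cvg_lim => //.
    exact: cvg_nnsfun_approx.
  - by move=> n; exact/measurable_EFinP.
  - by move=> n y _; rewrite lee_fin.
  - by move=> y _ a b ab; rewrite lee_fin; exact/lefP/nd_nnsfun_approx.
under eq_fun do rewrite integral_density_image_nnsfun.
rewrite -monotone_convergence//.
- apply: eq_integral => w _; apply/cvg_lim => //.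
  by apply: cvgeZr => //; exact: cvg_nnsfun_approx.
- move=> n; apply: emeasurable_funM; apply/measurable_EFinP => //.
  exact: measurableT_comp.
- by move=> n w _; rewrite mule_ge0 ?lee_fin.
- move=> w _ a b ab; rewrite lee_wpmul2r ?lee_fin//.
  exact/lefP/nd_nnsfun_approx.
Qed.

End density_image.

(** * Compact metrizable spaces *)

(** The topology is given beforehand and [dist] has to induce it: the state space carries a product
    of subspace topologies, to which its distance is tied by this predicate. *)
Definition metrizes (R : realType) (X : topologicalType) (dist : X -> X -> R) :=
  [/\ forall x, dist x x = 0, forall x y, dist x y = dist y x,
    forall x y z, dist x z <= dist x y + dist y z &
    forall x (Z : set X), nbhs x Z <->
      exists2 e, 0 < e & forall y, dist x y < e -> Z y].

Section metrizable.
Context (R : realType) (X : ptopologicalType) (dist : X -> X -> R).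
Hypothesis mX : metrizes dist.

Lemma metrizes_continuous c : continuous (dist c).
Proof.
have [d0 dC dT dn] := mX => x; apply/cvgrPdist_lt => e e0.
apply/dn; exists e => // y /le_lt_trans; apply.
rewrite ler_norml; apply/andP; split.
  by have := dT c x y; lra.
by have := dT c y x; rewrite (dC y); lra.
Qed.

Lemma compact_finite_net : compact [set: X] -> forall e, 0 < e ->
  exists s : seq X, forall x, exists2 c, c \in s & dist c x < e.
Proof.
have [d0 dC dT dn] := mX.
rewrite compact_cover => cX e e0.
have [||D _ cD] := cX X setT (fun z => [set y | dist z y < e]°).
- by move=> z _; exact: open_interior.
- move=> x _; exists x => //=; apply/dn; exists e => // y; exact.
exists (finmap.enum_fset D) => x.
by have [//|c /= cs /interior_subset] := cD x; exists c.
Qed.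

(** Tents of radius [e] over a finite [e]-net, divided by their sum, which is positive because every
    point is within [e] of the net. *)
Lemma partition_of_unity : compact [set: X] -> forall e, 0 < e ->
  exists n (c : 'I_n -> X) (phi : 'I_n -> X -> R),
    [/\ forall i, continuous (phi i), forall i x, 0 <= phi i x,
      forall x, \sum_i phi i x = 1 &
      forall i x, phi i x != 0 -> dist (c i) x < e].
Proof.
move=> cX e e0; have [s sP] := compact_finite_net cX e0.
pose c (i : 'I_(size s)) := tnth (in_tuple s) i.
pose b i x := Num.max 0 (e - dist (c i) x).
have b0 i x : 0 <= b i x by rewrite le_max lexx.
have cb i : continuous (b i).
  move=> x; apply: (@continuous_max _ _ (cst 0) (fun x => e - dist (c i) x)).
    exact: cvg_cst.
  by apply: cvgB; [exact: cvg_cst|exact: metrizes_continuous].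
have sb x : 0 < \sum_i b i x.
  have [z zs zx] := sP x.
  have [i zi] : exists i, z = c i.
    by have /tnthP[i ->] : z \in in_tuple s by []; exists i.
  rewrite (bigD1 i)//= ltr_wpDr ?sumr_ge0// /b -zi.
  by rewrite lt_max subr_gt0 zx orbT.
exists (size s), c, (fun i x => b i x / \sum_j b j x); split.
- move=> i x; apply: cvgM; first exact: cb.
  apply: cvgV; first by rewrite gt_eqF.
  by apply: continuous_big => [|j _]; [exact: add_continuous|exact: cb].
- by move=> i x; rewrite divr_ge0// ltW.
- by move=> x; rewrite -mulr_suml divff// gt_eqF.
- move=> i x; apply: contraNT; rewrite -leNgt => h.
  by rewrite /b max_l ?mul0r// subr_le0.
Qed.

(* [X * X] carries the Borel sets of the product topology; second countability
   of [X] puts them in the product sigma-algebra. *)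
Lemma measurable_pair_borel disp (Om : measurableType disp) (f g : Om -> X) :
  compact [set: X] ->
  measurable_fun setT (f : Om -> borel X) ->
  measurable_fun setT (g : Om -> borel X) ->
  measurable_fun setT ((fun w => (f w, g w)) : Om -> borel (X * X)%type).
Proof.
move=> cX mf mg; have [d0 dC dT dn] := mX.
pose r n : R := n.+1%:R^-1.
have r0 n : 0 < r n by rewrite invr_gt0.
have [net netP] := choice (fun n : nat => compact_finite_net cX (r0 n)).
(* Indexing by all natural numbers makes the base countable; indices beyond the net give [point],
   which only adds further balls. *)
pose c n i := nth point (net n) i.
pose B (k : nat * nat * nat) : set (X * X) :=
  [set z | dist (c k.1.1 k.1.2) z.1 < r k.1.1 /\
           dist (c k.1.1 k.2) z.2 < r k.1.1].
have dle x y e : dist x y < e -> forall z, dist z x < e -> dist z y < e + e.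
  by move=> xy z zx; rewrite (le_lt_trans (dT _ x _))// ltrD.
apply: (@countable_base_borel_measurable _ Om (X * X)%type _ B).
- move=> Z [x y] oZ Zxy.
  have : nbhs (x, y) Z by apply: open_nbhs_nbhs.
  case=> -[U V] /= [/dn[e e0 eU] /dn[e' e'0 eV] UVZ].
  (* Twice [r n] lies below both radii, so a ball of radius [r n] that contains the point lies in
     its neighborhood. *)
  have [|n] := @ltr_add_invr R 0 (Num.min e e' / 2).
    by rewrite divr_gt0// lt_min e0.
  rewrite add0r -/(r n) ltr_pdivlMr// mulr_natr mulr2n lt_min => /andP[rne rne'].
  have [_ /(nthP point)[i _ <-] xi] := netP n x.
  have [_ /(nthP point)[j _ <-] yj] := netP n y.
  exists (n, i, j) => // -[a b] [/= ai bj]; apply: UVZ; split => /=.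
    by apply: eU; apply: lt_trans rne; apply: dle ai _ _; rewrite dC.
  by apply: eV; apply: lt_trans rne'; apply: dle bj _ _; rewrite dC.
- move=> [[n i] j].
  have mB (h : Om -> X) a e : measurable_fun setT (h : Om -> borel X) ->
      measurable [set w | dist a (h w) < e].
    move=> mh; rewrite -[X in measurable X]setTI.
    apply: (mh _ [set y | dist a y < e]) => //.
    apply: sub_sigma_algebra.
    have /continuousP cd := @metrizes_continuous a; exact: cd _ (@open_lt _ e).
  have -> : (fun w => (f w, g w)) @^-1` B (n, i, j) =
      [set w | dist (c n i) (f w) < r n] `&`
      [set w | dist (c n j) (g w) < r n] by [].
  by apply: measurableI; exact: mB.
Qed.

End metrizable.

(** * Asymptotically equal families of measures *)

Lemma bounded_of_le (R : realType) (T : Type) (f : T -> R) (M : R) :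
  (forall x, `|f x| <= M) -> [bounded f x | x in [set: T]].
Proof.
move=> fM; exists M; split=> [|x Mx y _ /=]; first exact: num_real.
exact: le_trans (fM y) (ltW Mx).
Qed.

Lemma partition_norm_le1 (R : realType) (T : Type) n (phi : 'I_n -> T -> R) :
  (forall i x, 0 <= phi i x) -> (forall x, \sum_i phi i x = 1) ->
  forall i x, `|phi i x| <= 1.
Proof.
move=> phi0 phi1 i x; rewrite ger0_norm// -(phi1 x) (bigD1 i)//= lerDl.
by apply: sumr_ge0 => j _; exact: phi0.
Qed.

(** * Integrals of bounded functions against a probability *)

Section probability_integral.
Context d (T : measurableType d) (R : realType) (P : probability T R).
Implicit Types (f g : T -> R) (M : R).

Lemma bounded_integrable f M : measurable_fun setT f ->
  (forall x, `|f x| <= M) -> P.-integrable setT (EFin \o f).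
Proof.
move=> mf fM; apply: measurable_bounded_integrable => //.
  by apply: le_lt_trans (probability_le1 P measurableT) _; rewrite ltry.
exact: bounded_of_le fM.
Qed.

Lemma Rintegral_cst_prob (r : R) : \int[P]_x r = r.
Proof.
rewrite Rintegral_cst// -[RHS]mulr1; congr (_ * _).
by have := @probability_setT _ _ _ P => /= ->.
Qed.

Lemma normr_Rintegral_le f M : measurable_fun setT f ->
  (forall x, `|f x| <= M) -> `|\int[P]_x f x| <= M.
Proof.
move=> mf fM; have fi := bounded_integrable mf fM.
rewrite (le_trans (le_normr_Rintegral _ fi))//.
rewrite -[leRHS]Rintegral_cst_prob.
apply: le_Rintegral => //.
  exact: (integrable_norm fi).
have /(_ `|M|) := @bounded_integrable (cst M); apply => // x.
Qed.

Lemma Rintegral_sum (n : nat) (F : 'I_n -> T -> R) :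
  (forall i, P.-integrable setT (EFin \o F i)) ->
  \int[P]_x (\sum_i F i x) = \sum_i \int[P]_x F i x.
Proof.
elim: n F => [|n IH] F iF.
  by under eq_Rintegral do rewrite big_ord0; rewrite big_ord0 Rintegral_cst// mul0r.
under eq_Rintegral do rewrite big_ord_recl.
rewrite RintegralD//.
  by rewrite IH// big_ord_recl.
rewrite (_ : _ \o _ = fun x => \sum_(i < n) (EFin \o F (lift ord0 i)) x)%E.
  by apply: integrable_sum.
by apply/funext => x /=; rewrite sumEFin.
Qed.

(** Since the [phi i] sum to one, the difference is the integral of [\sum_i (k x - v i) * phi i x],
    and where [phi i] does not vanish its factor is at most [e]. *)
Lemma Rintegral_partition n (phi : 'I_n -> T -> R) (k : T -> R) (v : 'I_n -> R) (e M : R) :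
  (forall i, measurable_fun setT (phi i)) -> (forall i x, 0 <= phi i x) ->
  (forall x, \sum_i phi i x = 1) ->
  measurable_fun setT k -> (forall x, `|k x| <= M) -> 0 <= e ->
  (forall i x, phi i x != 0 -> `|k x - v i| <= e) ->
  `|\int[P]_x k x - \sum_i v i * \int[P]_x phi i x| <= e.
Proof.
move=> mphi phi0 phi1 mk kM e0 kv.
have phile := partition_norm_le1 phi0 phi1.
have iphi i : P.-integrable setT (EFin \o phi i) by exact: bounded_integrable.
have ivphi i : P.-integrable setT (EFin \o (fun x => v i * phi i x)).
  apply: (@bounded_integrable _ `|v i|); first exact: measurable_funM.
  by move=> x; rewrite normrM ler_piMr.
have -> : \sum_i v i * \int[P]_x phi i x = \int[P]_x (\sum_i v i * phi i x).
  by rewrite Rintegral_sum//; apply: eq_bigr => i _; rewrite RintegralZl.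
rewrite -RintegralB//.
- apply: normr_Rintegral_le.
    apply: measurable_funB => //; apply: measurable_sum => i.
    exact: measurable_funM.
  move=> x; have -> : k x - \sum_i v i * phi i x =
      \sum_i (k x - v i) * phi i x.
    rewrite -{1}(mulr1 (k x)) -(phi1 x) mulr_sumr -sumrB.
    by apply: eq_bigr => i _; rewrite mulrBl.
  rewrite (le_trans (ler_norm_sum _ _ _))// -[leRHS](mulr1 e) -(phi1 x) mulr_sumr.
  apply: ler_sum => i _; rewrite normrM (ger0_norm (phi0 i x)).
  have [->|h] := eqVneq (phi i x) 0; first by rewrite !mulr0.
  by rewrite ler_wpM2r// kv.
- exact: bounded_integrable kM.
- rewrite (_ : _ \o _ = fun x => (\sum_i (v i * phi i x)%:E)%E).
    by apply: (@integrable_sum _ _ _ _ _ _ _ _ _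
      (fun i => EFin \o (fun x => v i * phi i x))).
  by apply/funext => x /=; rewrite sumEFin.
Qed.

End probability_integral.

Section asymptotic_equality.
Context (R : realType) (X : ptopologicalType).

(** Two moving families are compared with each other rather than with a limit, so the index may
    range over all measures at once; this is how uniformity is expressed. *)
Definition asymp_eq I (G : set_system I) (mu nu : I -> bprob R X) :=
  forall h : X -> R, continuous h -> [bounded h x | x in [set: X]] ->
    (\int[mu i]_x h x - \int[nu i]_x h x) @[i --> G] --> (0 : R).

Lemma compact_bounded_continuous (h : X -> R) : compact [set: X] ->
  continuous h -> exists M, forall x, `|h x| <= M.
Proof.
move=> cX ch.
have : bounded_set (h @` setT).
  apply: compact_bounded; apply: continuous_compact => // x.
  by apply: continuous_subspaceT.
case=> M [_ hM]; exists (M + 1) => x.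
by apply: (hM (M + 1)); [rewrite ltrDl|exists x].
Qed.

Context (dist : X -> X -> R).
Hypotheses (mX : metrizes dist) (cX : compact [set: X]).

(** The hypotheses are local at each [x0]. Near-covering compactness, with pairs of an index and a
    radius as parameter, yields one radius and one set of indices for all points. *)
Lemma near_uniform I (G : set_system I) {FG : Filter G} (k l : I -> X -> R) :
  (forall x0, (k p.1 p.2 - l p.1 x0) @[p --> filter_prod G (nbhs x0)] --> (0 : R)) ->
  (forall x0, (l p.1 p.2 - l p.1 x0) @[p --> filter_prod G (nbhs x0)] --> (0 : R)) ->
  forall e, 0 < e -> exists2 r, 0 < r & \forall i \near G,
    forall x y, dist x y < r -> `|k i x - l i y| < e.
Proof.
have [d0 dC dT dn] := mX => kl ll e e0.
pose P (p : I * R) x := forall y, dist x y < p.2 -> `|k p.1 x - l p.1 y| < e.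
have e20 : 0 < e / 2 by rewrite divr_gt0.
have := (@compact_near_coveringP X setT).1 cX _ (filter_prod G (0 : R)^'+) P _.
case.
  move=> x0 _.
  have /cvgrPdist_lt/(_ _ e20)[[A B]/= [GA /dn[b b0 bB]] AB] := kl x0.
  have /cvgrPdist_lt/(_ _ e20)[[A' B']/= [GA' /dn[b' b'0 b'B]] AB'] := ll x0.
  (* Halving the radius keeps [y] as well as [x] in the balls about [x0]. *)
  exists ([set x | dist x0 x < Num.min b b' / 2],
    (A `&` A') `*` [set r | r < Num.min b b' / 2]) => /=.
    split; first by apply/dn; exists (Num.min b b' / 2) => //; rewrite divr_gt0// lt_min b0.
    exists (A `&` A', [set r | r < Num.min b b' / 2]) => //=; split.
      exact: filterI.
    by apply: nbhs_right_lt; rewrite divr_gt0// lt_min b0.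
  move=> [x [i r]] /= [xb [[Ai A'i] rb]] y /= xy.
  have mb : Num.min b b' <= b by rewrite ge_min lexx.
  have mb' : Num.min b b' <= b' by rewrite ge_min lexx orbT.
  have x0x : dist x0 x < b.
    by have := dT x x0 x; rewrite (dC x x0) d0; lra.
  have x0y : dist x0 y < b' by have := dT x0 x y; lra.
  have := AB (i, x) (conj Ai (bB _ x0x)).
  have := AB' (i, y) (conj A'i (b'B _ x0y)).
  rewrite /= !sub0r !normrN !ltr_norml => /andP[? ?] /andP[? ?].
  by apply/andP; split; lra.
move=> [A B] /= [GA [r /= r0 rB]] AB.
exists (r / 2); first by rewrite divr_gt0.
apply: filterS GA => i Ai x y xy.
apply: (AB (i, r / 2)) => //=; split => //; apply: rB; last by rewrite divr_gt0.
by rewrite /= sub0r normrN gtr0_norm ?divr_gt0//; lra.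
Qed.

(** Up to [e / 4], each integral is a combination, with the same coefficients [l i (c j)], of the
    means of a partition of unity under its own measure. These means become close, and the
    coefficients are bounded by [M] uniformly in [i]. *)
Lemma asymp_eq_integral I (G : set_system I) {FG : Filter G}
    (mu nu : I -> bprob R X) (k l : I -> X -> R) (M : R) :
  asymp_eq G mu nu ->
  (forall i, measurable_fun setT (k i : borel X -> R)) ->
  (forall i, measurable_fun setT (l i : borel X -> R)) ->
  (forall i, exists M', forall x, `|k i x| <= M') ->
  (forall i x, `|l i x| <= M) ->
  (forall x0, (k p.1 p.2 - l p.1 x0) @[p --> filter_prod G (nbhs x0)] --> (0 : R)) ->
  (forall x0, (l p.1 p.2 - l p.1 x0) @[p --> filter_prod G (nbhs x0)] --> (0 : R)) ->
  (\int[mu i]_x k i x - \int[nu i]_x l i x) @[i --> G] --> (0 : R).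
Proof.
move=> mn mk ml kM lM kl ll; apply/cvgrPdist_lt => e e0.
have e40 : 0 < e / 4 by rewrite divr_gt0.
have [r r0 nr] := near_uniform kl ll e40.
have [r' r'0 nr'] := near_uniform ll ll e40.
have [|n [c [phi [cphi phi0 phi1 phic]]]] := @partition_of_unity _ _ _ mX cX
  (Num.min r r'); first by rewrite lt_min r0.
have mphi i : measurable_fun setT (phi i : borel X -> R).
  exact: continuous_borel_measurable.
have bphi i : [bounded phi i x | x in [set: X]].
  have [K hK] := compact_bounded_continuous cX (cphi i).
  exact: bounded_of_le hK.
have sum0 : (\sum_j M * `|\int[mu i]_x phi j x - \int[nu i]_x phi j x|)
    @[i --> G] --> (0 : R).
  have s0 : \sum_(j < n) (0 : R) = 0 by rewrite big1.
  rewrite -[X in _ --> X]s0.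
  have addc : continuous (fun x : R * R => x.1 + x.2) by exact: add_continuous.
  apply: (@cvg_big R 'I_n +%R 0 xpredT addc _ _ _
    (fun j i => M * `|\int[mu i]_x phi j x - \int[nu i]_x phi j x|) _ FG) => j _.
  rewrite -(mulr0 M); apply: cvgM; first exact: cvg_cst.
  rewrite -(normr0 R); apply: cvg_norm; exact: mn.
have /cvgrPdist_lt/(_ _ e40) := sum0.
apply: filterS2 (filterI nr nr') => i [nri nri'].
rewrite !sub0r !normrN => si.
have dmin (x y : X) : dist x y < Num.min r r' -> dist y x < r /\ dist y x < r'.
  by have [_ dC _ _] := mX; rewrite lt_min (dC y) => /andP.
have [M' kM'] := kM i.
have h1 := @Rintegral_partition _ _ _ (mu i) n phi (k i) (fun j => l i (c j)) (e/4) M'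
  mphi phi0 phi1 (mk i) kM' (ltW e40)
  (fun j x h => ltW (nri _ _ (dmin _ _ (phic j x h)).1)).
have h2 := @Rintegral_partition _ _ _ (nu i) n phi (l i) (fun j => l i (c j)) (e/4) M
  mphi phi0 phi1 (ml i) (lM i) (ltW e40)
  (fun j x h => ltW (nri' _ _ (dmin _ _ (phic j x h)).2)).
have h3 : `|\sum_j l i (c j) * \int[mu i]_x phi j x -
    \sum_j l i (c j) * \int[nu i]_x phi j x| < e / 4.
  rewrite -sumrB; apply: le_lt_trans (ler_norm_sum _ _ _) _.
  apply: le_lt_trans _ (le_lt_trans (ler_norm _) si).
  apply: ler_sum => j _; rewrite -mulrBr normrM ler_wpM2r//.
move: h1 h2 h3; rewrite !ler_norml !ltr_norml.
by move=> /andP[? ?] /andP[? ?] /andP[? ?]; apply/andP; split; lra.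
Qed.

End asymptotic_equality.

(** * Transport cost *)

Lemma EFin_Rintegral_bounded d (T : measurableType d) (R : realType)
    (P : probability T R) (f : T -> R) M :
  measurable_fun setT f -> (forall x, `|f x| <= M) ->
  (\int[P]_x (f x)%:E)%E = (\int[P]_x f x)%:E.
Proof.
move=> mf fM; rewrite /Rintegral fineK//.
by apply: integrable_fin_num => //; exact: bounded_integrable fM.
Qed.

Section transport_cost.
Context (R : realType) (X : ptopologicalType).

(** At the state space this is convertible to [coupling], so that [W2] is by conversion the root of
    [transport_cost]. *)
Definition couplings (P Q : bprob R X) : set (bprob R (X * X)%type) :=
  [set pi | forall B : set (borel X), measurable B ->
     pi (fst @^-1` B) = P B /\ pi (snd @^-1` B) = Q B].

Definition transport_cost (c : X * X -> R) (P Q : bprob R X) : \bar R :=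
  ereal_inf [set (\int[pi]_z (c z)%:E)%E | pi in couplings P Q].

Lemma measurable_fst_borel :
  measurable_fun setT (fst : borel (X * X)%type -> borel X).
Proof. by apply: continuous_borel_measurable2 => x; exact: cvg_fst. Qed.

Lemma measurable_snd_borel :
  measurable_fun setT (snd : borel (X * X)%type -> borel X).
Proof. by apply: continuous_borel_measurable2 => x; exact: cvg_snd. Qed.

Lemma integral_coupling_fst (P Q : bprob R X) pi (f : X -> \bar R) :
  couplings P Q pi -> measurable_fun setT (f : borel X -> \bar R) ->
  (forall x, 0 <= f x)%E ->
  (\int[pi]_z f z.1 = \int[P]_x f x)%E.
Proof.
move=> piPQ mf f0.
transitivity (\int[pushforward_prob measurable_fst_borel pi]_x f x)%E.
  by rewrite ge0_integral_distribution.
by apply: eq_measure_integral => B mB _; exact: (piPQ B mB).1.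
Qed.

Lemma couplings_swap (P Q : bprob R X) pi (c : X * X -> R) :
  couplings P Q pi -> measurable_fun setT (c : borel (X * X)%type -> R) ->
  (forall z, 0 <= c z) ->
  exists2 pi', couplings Q P pi' &
    (\int[pi']_z (c z)%:E = \int[pi]_z (c (z.2, z.1))%:E)%E.
Proof.
move=> piPQ mc c0.
have msw : measurable_fun [set: borel (X * X)%type]
    ((fun z => (z.2, z.1)) : borel (X * X)%type -> borel (X * X)%type).
  apply: (@continuous_borel_measurable2 (X * X)%type (X * X)%type) => z.
  by apply: cvg_pair => /=; [exact: cvg_snd|exact: cvg_fst].
exists (pushforward_prob msw pi).
  move=> B mB; have [<- <-] := piPQ B mB.
  by split; rewrite [LHS]pushforward_probE.
by rewrite ge0_integral_distribution//; exact/measurable_EFinP.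
Qed.

Context (dist : X -> X -> R).
Hypotheses (mX : metrizes dist) (cX : compact [set: X]).

(* [pi'] is the image of [g x' x] times [P' \x pi] under
   [(x', (x, y)) |-> (x', y)]. *)
Lemma couplings_reweight (P P' Q : bprob R X) pi (g : X -> X -> R) :
  couplings P Q pi ->
  measurable_fun setT (fun z : borel X * borel X => g z.1 z.2) ->
  (forall x y, 0 <= g x y) ->
  (forall y, \int[P']_x (g x y)%:E = 1)%E ->
  (forall x, \int[P]_y (g x y)%:E = 1)%E ->
  exists2 pi', couplings P' Q pi' &
    forall h k : X * X -> \bar R,
      measurable_fun setT (h : borel (X * X)%type -> \bar R) ->
      measurable_fun setT (k : borel (X * X)%type -> \bar R) ->
      (forall z, 0 <= h z)%E ->
      (forall z, \int[P']_x (h (x, z.2) * (g x z.1)%:E) <= k z)%E ->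
      (\int[pi']_z h z <= \int[pi]_z k z)%E.
Proof.
move=> piPQ mg g0 gP' gP.
pose Om := (borel X * borel (X * X)%type)%type.
pose tau (w : Om) : borel (X * X)%type := (w.1, w.2.2).
pose gg (w : Om) := g w.1 w.2.1.
have mtau : measurable_fun setT tau.
  apply: (measurable_pair_borel mX cX) => //.
  exact: (measurableT_comp measurable_snd_borel).
have mgg : measurable_fun setT gg.
  have mk : measurable_fun setT
      ((fun w => (w.1, w.2.1)) : Om -> (borel X * borel X)%type).
    apply: measurable_fun_pair => //.
    exact: (measurableT_comp measurable_fst_borel).
  exact: (measurableT_comp mg mk).
have mEgg : measurable_fun setT (EFin \o gg) by exact/measurable_EFinP.
have mgx x : measurable_fun setT (fun y : borel X => (g x y)%:E).
  apply/measurable_EFinP.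
  have mk : measurable_fun setT
      ((fun y => (x, y)) : borel X -> (borel X * borel X)%type).
    exact: measurable_fun_pair.
  exact: (measurableT_comp mg mk).
have gpi x : (\int[pi]_z (g x z.1)%:E = 1)%E.
  by rewrite (integral_coupling_fst (f := fun y => (g x y)%:E) piPQ)// => y; rewrite lee_fin.
pose m : {measure set _ -> \bar R} := (P' \x pi)%E.
have gg1 : (\int[m]_w (gg w)%:E = 1)%E.
  rewrite fubini_tonelli1//; last by move=> w; rewrite lee_fin; exact: g0.
  under eq_integral do rewrite /fubini_F gpi.
  by rewrite integral_cst// mul1e; exact: probability_setT.
have gg0 w : 0 <= gg w by exact: g0.
pose nu : bprob R (X * X)%type := density_image_prob mgg gg0 mtau gg1.
have mw h : measurable_fun setT (h : borel (X * X)%type -> \bar R) ->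
    measurable_fun setT (fun w : Om => h (tau w) * (gg w)%:E)%E.
  by move=> mh; apply: emeasurable_funM => //; exact: (measurableT_comp mh mtau).
(* Both orders of integration are used: the inner integral over [pi] gives the first marginal, the
   inner integral over [P'] gives the second marginal and the bound on costs. *)
have nuE1 h : measurable_fun setT (h : borel (X * X)%type -> \bar R) ->
    (forall z, 0 <= h z)%E ->
    (\int[nu]_z h z =
     \int[P']_x \int[pi]_z (h (x, z.2) * (g x z.1)%:E))%E.
  move=> mh h0; rewrite integral_density_image// fubini_tonelli1//.
    exact: mw.
  by move=> w; rewrite mule_ge0// lee_fin; exact: g0.
have nuE2 h : measurable_fun setT (h : borel (X * X)%type -> \bar R) ->
    (forall z, 0 <= h z)%E ->
    (\int[nu]_z h z =
     \int[pi]_z \int[P']_x (h (x, z.2) * (g x z.1)%:E))%E.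
  move=> mh h0; rewrite nuE1//.
  have := @fubini_tonelli _ _ _ _ _ P' pi (fun w : Om => h (tau w) * (gg w)%:E)%E.
  apply; first exact: mw.
  by move=> w; rewrite mule_ge0// lee_fin; exact: g0.
exists nu; last first.
  move=> h k mh mk h0 hk; rewrite nuE2//.
  have hg0 w : (0 <= h (tau w) * (gg w)%:E)%E by rewrite mule_ge0 ?lee_fin.
  have i0 z : (0 <= \int[P']_x (h (x, z.2) * (g x z.1)%:E))%E.
    by apply: integral_ge0 => x _; exact: (hg0 (x, z)).
  apply: ge0_le_integral => //.
  exact: (@measurable_fun_fubini_tonelli_G _ _ _ _ _ P' _ (mw h mh) hg0).
have mI (A : set (borel (X * X)%type)) : measurable A -> measurable_fun setT
    (fun z : borel (X * X)%type => (\1_A z)%:E : \bar R).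
  by move=> mA; apply/measurable_EFinP; exact: measurable_indic.
have nuI (A : set (borel (X * X)%type)) : measurable A ->
    nu A = (\int[nu]_z (\1_A z)%:E)%E.
  by move=> mA; rewrite integral_indic// setIT.
move=> B mB; split.
- have mA : measurable (fst @^-1` B : set (borel (X * X)%type)).
    by rewrite -[X in measurable X]setTI; exact: measurable_fst_borel.
  rewrite nuI// nuE1; [|exact: mI|by move=> z; rewrite lee_fin].
  transitivity (\int[P']_x (\1_B x)%:E)%E; last by rewrite integral_indic// setIT.
  apply: eq_integral => x _.
  have e y : \1_(fst @^-1` B) (x, y) = \1_B x :> R.
    by rewrite !indicE; congr (_ _)%:R; apply/idP/idP; rewrite !inE.
  under eq_integral do rewrite e.
  rewrite ge0_integralZl//; last 2 first.
    exact: (measurableT_comp (mgx x) measurable_fst_borel).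
    by move=> z _; rewrite lee_fin.
  by rewrite gpi mule1.
- have mA : measurable (snd @^-1` B : set (borel (X * X)%type)).
    by rewrite -[X in measurable X]setTI; exact: measurable_snd_borel.
  rewrite nuI// nuE2; [|exact: mI|by move=> z; rewrite lee_fin].
  transitivity (\int[pi]_z (\1_(snd @^-1` B) z)%:E)%E; last first.
    by rewrite integral_indic// setIT; exact: (piPQ B mB).2.
  apply: eq_integral => z _.
  have e x : \1_(snd @^-1` B) (x, z.2) = \1_(snd @^-1` B) z :> R.
    by rewrite !indicE; congr (_ _)%:R; apply/idP/idP; rewrite !inE.
  under eq_integral do rewrite e.
  rewrite ge0_integralZl//; last 2 first.
    have mk : measurable_fun setT
        ((fun x => (x, z.1)) : borel X -> (borel X * borel X)%type).
      exact: measurable_fun_pair.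
    by apply/measurable_EFinP; exact: (measurableT_comp mg mk).
    by move=> x _; rewrite lee_fin.
  by rewrite gP' mule1.
Qed.

(** Reweighting the diagonal coupling of [Q] with itself by the constant density one makes the two
    coordinates independent. *)
Lemma couplings_nonempty (P Q : bprob R X) : couplings P Q !=set0.
Proof.
have md : measurable_fun [set: borel X]
    ((fun x => (x, x)) : borel X -> borel (X * X)%type).
  apply: (@continuous_borel_measurable2 X (X * X)%type) => x.
  by apply: cvg_pair => /=; exact: cvg_id.
have dQ : couplings Q Q (pushforward_prob md Q) by move=> B mB; split.
have i1 (M : bprob R X) : (\int[M]_x (1%:E : \bar R) = 1)%E.
  by rewrite integral_cst// mul1e; exact: probability_setT.
have [//|//|//|//|pi' pi'PQ _] := @couplings_reweight Q P Q _ (fun _ _ => 1) dQ.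
by exists pi'.
Qed.

End transport_cost.

(** * Densities that resample within the cells of a partition of unity *)

Section mixing_density.
Context d (T : measurableType d) (R : realType) (n : nat).
Context (phi : 'I_n -> T -> R).
Hypotheses (mphi : forall i, measurable_fun setT (phi i))
  (phi0 : forall i x, 0 <= phi i x) (phi1 : forall x, \sum_i phi i x = 1).
Implicit Types (t a b w : 'I_n -> R) (x y : T).

Let phile := partition_norm_le1 phi0 phi1.

Let msum w : measurable_fun setT (fun x => \sum_i w i * phi i x).
Proof. by apply: measurable_sum => i; exact: measurable_funM. Qed.

(** In either variable alone, [diag_density] and [rest_density] are affine in the partition, so
    their integrals reduce to the means of the [phi i]. *)
Lemma integral_partition_affine (P : probability T R) w e :
  (\int[P]_x (\sum_i w i * phi i x + e)%:E =
   (\sum_i w i * \int[P]_x phi i x + e)%:E)%E.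
Proof.
have bnd x : `|\sum_i w i * phi i x| <= \sum_i `|w i|.
  apply: le_trans (ler_norm_sum _ _ _) _; apply: ler_sum => i _.
  by rewrite normrM ler_piMr.
have iF i : P.-integrable setT (EFin \o (fun x => w i * phi i x)).
  apply: (@bounded_integrable _ _ _ _ _ `|w i|); first exact: measurable_funM.
  by move=> x; rewrite normrM ler_piMr.
rewrite (@EFin_Rintegral_bounded _ _ _ _ _ (\sum_i `|w i| + `|e|)); last 2 first.
- by apply: measurable_funD.
- by move=> x; rewrite (le_trans (ler_normD _ _))// lerD2r.
rewrite RintegralD//; last 2 first.
- exact: bounded_integrable bnd.
- exact: (@bounded_integrable _ _ _ _ (cst e) `|e|).
rewrite Rintegral_sum// Rintegral_cst_prob; congr (_ + _)%:E.
apply: eq_bigr => i _; rewrite RintegralZl//.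
exact: (@bounded_integrable _ _ _ _ _ 1).
Qed.

(** Links [x] and [y] only through a common cell: it vanishes unless some [phi i] is nonzero at
    both, and then the points are close. *)
Definition diag_density t x y := \sum_i t i * phi i x * phi i y.

(* Couples the parts of the two marginals left over by [diag_density]
   independently. *)
Definition rest_density t a b x y :=
  (1 - \sum_i t i * a i * phi i x) * (1 - \sum_i t i * b i * phi i y) /
  (1 - \sum_i t i * a i * b i).

Lemma diag_densityC t x y : diag_density t x y = diag_density t y x.
Proof. by apply: eq_bigr => i _; rewrite mulrAC. Qed.

Lemma rest_densityC t a b x y : rest_density t a b x y = rest_density t b a y x.
Proof.
rewrite /rest_density mulrC (mulrC (1 - _)); rewrite mulrC; congr (_ / (1 - _)).
by apply: eq_bigr => i _; rewrite mulrAC.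
Qed.

(** The mean of [1 - \sum_i t i * a i * phi i x] under [P] is the denominator of [rest_density] and
    cancels it. The choice [A = B = 1] gives total mass one; other values bound the transport
    cost. *)
Lemma integral_mixing_density (P : probability T R) t a b (A B : R) y :
  (forall i, \int[P]_x phi i x = b i) -> \sum_i t i * a i * b i != 1 ->
  (\int[P]_x (A * diag_density t x y + B * rest_density t a b x y)%:E =
   (A * (\sum_i t i * b i * phi i y) +
    B * (1 - \sum_i t i * b i * phi i y))%:E)%E.
Proof.
move=> Pb s1; set v := \sum_i t i * b i * phi i y.
set s := \sum_i t i * a i * b i in s1 *.
pose w i := A * t i * phi i y - B * (1 - v) / (1 - s) * (t i * a i).
have s10 : 1 - s != 0 by rewrite subr_eq0 eq_sym.
transitivity (\int[P]_x (\sum_i w i * phi i x + B * (1 - v) / (1 - s))%:E)%E.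
  apply: eq_integral => x _; congr EFin.
  under [in RHS]eq_bigr do rewrite mulrBl.
  rewrite sumrB /diag_density /rest_density -/v -/s.
  have -> : \sum_i A * t i * phi i y * phi i x =
      A * \sum_i t i * phi i x * phi i y.
    by rewrite mulr_sumr; apply: eq_bigr => i _; ring.
  have -> : \sum_i B * (1 - v) / (1 - s) * (t i * a i) * phi i x =
      B * (1 - v) / (1 - s) * \sum_i t i * a i * phi i x.
    by rewrite mulr_sumr; apply: eq_bigr => i _; ring.
  by field.
rewrite integral_partition_affine; congr EFin.
under eq_bigr do rewrite Pb mulrBl.
rewrite sumrB.
have -> : \sum_i B * (1 - v) / (1 - s) * (t i * a i) * b i =
    B * (1 - v) / (1 - s) * s.
  by rewrite mulr_sumr; apply: eq_bigr => i _; ring.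
have -> : \sum_i A * t i * phi i y * b i = A * v.
  by rewrite mulr_sumr; apply: eq_bigr => i _; ring.
by field.
Qed.

End mixing_density.

(* [t i = (1 - eta) * min (a i) (b i) / (a i * b i)], which is [0] when [a i] or
   [b i] vanishes; [eta] keeps the mass left to [rest_density] positive. *)
Lemma mixing_weights (R : realType) n (a b : 'I_n -> R) (eta del : R) :
  (forall i, 0 <= a i) -> (forall i, 0 <= b i) ->
  \sum_i a i = 1 -> \sum_i b i = 1 -> 0 < eta <= 1 ->
  (forall i, `|a i - b i| <= del) ->
  exists t : 'I_n -> R, [/\ forall i, 0 <= t i,
    forall i, t i * a i <= 1, forall i, t i * b i <= 1,
    \sum_i t i * a i * b i < 1 &
    1 - \sum_i t i * a i * b i <= eta + n%:R * del].
Proof.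
move=> a0 b0 a1 b1 /andP[eta0 eta1] abd.
pose m i := Num.min (a i) (b i).
have m0 i : 0 <= m i by rewrite le_min a0 b0.
have ma i : m i <= a i by rewrite ge_min lexx.
have mb i : m i <= b i by rewrite ge_min lexx orbT.
pose t i := (1 - eta) * (m i / (a i * b i)).
have eta1' : 0 <= 1 - eta by rewrite subr_ge0.
have t0 i : 0 <= t i by rewrite mulr_ge0// divr_ge0// mulr_ge0.
have tab i : t i * a i * b i = (1 - eta) * m i.
  have [ab0|ab0] := eqVneq (a i * b i) 0.
    have -> : m i = 0.
      apply/eqP; rewrite eq_le m0 andbT.
      by move/eqP : ab0; rewrite mulf_eq0 => /orP[/eqP <-|/eqP <-].
    by rewrite -mulrA ab0 !mulr0.
  by rewrite -mulrA -mulrA divfK.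
(* [x] is one of [a i], [b i] and [y] the other; cancelling [x] leaves [(1 - eta) * (m i / y)]. *)
have le1 i (x y : R) : 0 <= x -> 0 <= y -> m i <= y ->
    a i * b i = x * y -> t i * x <= 1.
  move=> x0 y0 my xy; rewrite /t xy.
  have [->|xn0] := eqVneq x 0; first by rewrite mulr0 ler01.
  have [->|yn0] := eqVneq y 0; first by rewrite mulr0 invr0 !mulr0 mul0r ler01.
  have -> : (1 - eta) * (m i / (x * y)) * x = (1 - eta) * (m i / y).
    by field; rewrite xn0 yn0.
  have yp : 0 < y by rewrite lt_neqAle eq_sym yn0.
  have my1 : m i / y <= 1 by rewrite ler_pdivrMr// mul1r.
  have my0 : 0 <= m i / y by rewrite divr_ge0.
  by rewrite mulr_ile1// lerBlDr lerDl ltW.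
exists t; split => //.
- by move=> i; exact: (le1 i (a i) (b i)).
- by move=> i; apply: (le1 i (b i) (a i)) => //; rewrite mulrC.
- under eq_bigr do rewrite tab.
  rewrite -mulr_sumr.
  have : \sum_i m i <= 1 by rewrite -a1 ler_sum.
  have : 0 <= \sum_i m i by apply: sumr_ge0.
  by nra.
- under eq_bigr do rewrite tab.
  rewrite -mulr_sumr.
  have : \sum_i m i <= 1 by rewrite -a1 ler_sum.
  (* Each minimum falls short of [a i] by at most [del]. With M the sum of the minima, the left side
     of the goal is [(1 - M) + eta * M]. *)
  have : 1 - n%:R * del <= \sum_i m i.
    have -> : n%:R * del = \sum_(i < n) del.
      by rewrite sumr_const card_ord mulr_natl.
    rewrite -a1 -sumrB; apply: ler_sum => i _.
    have := abd i; rewrite ler_norml /m => /andP[? ?].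
    by rewrite le_min; apply/andP; split; lra.
  by nra.
Qed.

(** * Continuity of the transport cost in both marginals *)

Section transport_continuity.
Context (R : realType) (X : ptopologicalType) (dist : X -> X -> R).
Hypotheses (mX : metrizes dist) (cX : compact [set: X]).
Context (c : X * X -> R).
Hypotheses (cc : continuous c) (c0 : forall z, 0 <= c z).

Lemma compact_setTX : compact [set: X * X].
Proof. by rewrite -setXTT; exact: compact_setX. Qed.

(** Uniform continuity in the first variable, by near-covering compactness of [X * X] with the
    radius as parameter. *)
Lemma cost_modulus e : 0 < e -> exists2 r, 0 < r &
  forall x x' y, dist x x' < r -> `|c (x', y) - c (x, y)| <= e.
Proof.
have [d0 dC dT dn] := mX => e0.
pose P (r : R) (z : X * X) :=
  forall x', dist z.1 x' < r -> `|c (x', z.2) - c z| <= e.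
have e20 : 0 < e / 2 by rewrite divr_gt0.
have := (@compact_near_coveringP (X * X)%type setT).1 compact_setTX _ (0 : R)^'+ P _.
case.
  move=> [x0 y0] _.
  have /cvgrPdist_lt/(_ _ e20)[[A B]/= [/dn[b b0 bA] By0] AB] := @cc (x0, y0).
  exists ([set x | dist x0 x < b / 2] `*` B, [set r | r < b / 2]) => /=.
    split; last by apply: nbhs_right_lt; rewrite divr_gt0.
    exists ([set x | dist x0 x < b / 2], B) => //=; split => //.
    by apply/dn; exists (b / 2) => //; rewrite divr_gt0.
  move=> [[x y] r] /= [[x0x yB] rb] x' /= xx'.
  have x0x' : dist x0 x' < b by have := dT x0 x x'; lra.
  have x0xb : dist x0 x < b.
    have := dT x x0 x; rewrite (dC x x0) d0; lra.
  have := AB (x', y) (conj (bA _ x0x') yB).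
  have := AB (x, y) (conj (bA _ x0xb) yB).
  rewrite /= !ltr_norml ler_norml => /andP[? ?] /andP[? ?].
  by apply/andP; split; lra.
move=> r /= r0 rP.
exists (r / 2); first by rewrite divr_gt0.
move=> x x' y xx'; apply: (rP (r / 2) _ _ (x, y)) => //=.
  by rewrite sub0r normrN gtr0_norm ?divr_gt0//; lra.
by rewrite divr_gt0.
Qed.

(** Given a coupling of [P] and [Q], the first coordinate is resampled with density [D + E] against
    [P']. Under [D] it moves by less than [r], which changes the cost by at most [e / 2]; the mass
    [1 - s] of [E] is at most [eta + n * del] and costs at most [C] per unit, hence again at most
    [e / 2]. *)
Lemma transport_cost_perturb e : 0 < e ->
  exists n (phi : 'I_n -> X -> R) del, [/\ forall i, continuous (phi i),
    0 < del & forall P P' Q : bprob R X,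
    (forall i, `|\int[P]_x phi i x - \int[P']_x phi i x| <= del) ->
    (transport_cost c P' Q <= transport_cost c P Q + e%:E)%E].
Proof.
have [d0 dC dT dn] := mX => e0.
have [C0 C0P] : exists M, forall z, `|c z| <= M.
  exact: (compact_bounded_continuous compact_setTX cc).
(* Adding one makes the bound positive, as the divisions by [C] require. *)
pose C := C0 + 1.
have cC z : c z <= C by rewrite (le_trans (ler_norm _))// (le_trans (C0P z))// lerDl.
have Cp : 0 < C by rewrite ltr_wpDl// (le_trans _ (C0P point)).
have e20 : 0 < e / 2 by rewrite divr_gt0.
have [r r0 rP] := cost_modulus e20.
(* Two points of one cell are each within [r / 2] of its center, hence within [r] of each other. *)
have r20 : 0 < r / 2 by rewrite divr_gt0.
have [n [z [phi [cphi phi0 phi1 phiz]]]] := partition_of_unity mX cX r20.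
(* [eta] and [del] are such that [C * eta] and [C * n * del] are at most [e / 4]; [n.+1] keeps the
   denominator of [del] nonzero. *)
pose eta := Num.min 1 (e / (4 * C)).
have eta01 : 0 < eta <= 1.
  by rewrite /eta lt_min ltr01 divr_gt0 ?mulr_gt0//= ge_min lexx.
pose del := e / (4 * C * n.+1%:R).
have del0 : 0 < del by rewrite divr_gt0// !mulr_gt0.
exists n, phi, del; split => // P P' Q PP'.
rewrite -leeBlDr//; apply: le_ereal_inf_tmp => _ [pi piPQ <-]; rewrite leeBlDr//.
have mphi i : measurable_fun setT (phi i : borel X -> R).
  exact: continuous_borel_measurable.
have phile := partition_norm_le1 phi0 phi1.
pose a i := \int[P]_x phi i x.
pose b i := \int[P']_x phi i x.
have mean0 (M : bprob R X) i : 0 <= \int[M]_x phi i x by exact: Rintegral_ge0.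
have mean1 (M : bprob R X) : \sum_i \int[M]_x phi i x = 1.
  have := integral_partition_affine mphi phi0 phi1 M (fun=> 1) 0.
  under eq_integral do (rewrite addr0; under eq_bigr do rewrite mul1r).
  under eq_integral do rewrite phi1.
  rewrite integral_cst// mul1e => h.
  have := probability_setT M; rewrite h addr0 => -[<-].
  by apply: eq_bigr => i _; rewrite mul1r.
have [t [t0 ta tb s1 sle]] := mixing_weights (mean0 P) (mean0 P') (mean1 P)
  (mean1 P') eta01 PP'.
rewrite -/a -/b in ta tb s1 sle.
pose u x := \sum_i t i * a i * phi i x.
pose v x := \sum_i t i * b i * phi i x.
pose s := \sum_i t i * a i * b i.
have a0 i : 0 <= a i by exact: mean0.
have b0 i : 0 <= b i by exact: mean0.
have uP x : 0 <= u x <= 1.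
  rewrite sumr_ge0 /=; last by move=> i _; rewrite !mulr_ge0.
  by rewrite -(phi1 x); apply: ler_sum => i _; rewrite ler_piMl.
have vP x : 0 <= v x <= 1.
  rewrite sumr_ge0 /=; last by move=> i _; rewrite !mulr_ge0.
  by rewrite -(phi1 x); apply: ler_sum => i _; rewrite ler_piMl.
pose D x y := @diag_density _ (borel X) R n phi t x y.
pose E x y := @rest_density _ (borel X) R n phi t a b x y.
have D0 x y : 0 <= D x y by apply: sumr_ge0 => i _; rewrite !mulr_ge0.
have E0 x y : 0 <= E x y.
  have /andP[_ u1] := uP x; have /andP[_ v1] := vP y.
  by rewrite /E /rest_density divr_ge0 ?mulr_ge0 ?subr_ge0// ltW.
have sn1 : s != 1 by rewrite lt_eqF.
have intDE A B y : (\int[P']_x (A * D x y + B * E x y)%:E =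
    (A * v y + B * (1 - v y))%:E)%E.
  exact: (integral_mixing_density mphi phi0 phi1).
have mphi1 i : measurable_fun setT (fun z : borel X * borel X => phi i z.1).
  exact: (measurableT_comp (mphi i)).
have mphi2 i : measurable_fun setT (fun z : borel X * borel X => phi i z.2).
  exact: (measurableT_comp (mphi i)).
have mD : measurable_fun setT (fun z : borel X * borel X => D z.1 z.2).
  apply: measurable_sum => i; apply: measurable_funM => //.
  exact: measurable_funM.
have mE : measurable_fun setT (fun z : borel X * borel X => E z.1 z.2).
  apply: measurable_funM => //; apply: measurable_funM.
    apply: measurable_funB => //; apply: measurable_sum => i.
    exact: measurable_funM.
  apply: measurable_funB => //; apply: measurable_sum => i.
  exact: measurable_funM.
have [||||pi' pi'PQ pi'E] := couplings_reweight mX cX (P' := P')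
  (g := fun x y => D x y + E x y) piPQ.
- exact: measurable_funD.
- by move=> x y; rewrite addr_ge0.
- move=> y; under eq_integral do rewrite -(mul1r (D _ _)) -(mul1r (E _ _)).
  by rewrite intDE !mul1r subrKC.
- move=> x; under eq_integral do
    rewrite -(mul1r (D _ _)) -(mul1r (E _ _)) /D /E diag_densityC rest_densityC.
  rewrite (integral_mixing_density mphi phi0 phi1)//.
    by rewrite !mul1r subrKC.
  by rewrite (eq_bigr (fun i => t i * a i * b i)) // => i _; rewrite mulrAC.
have mc : measurable_fun setT (c : borel (X * X)%type -> R).
  exact: (@continuous_borel_measurable R (X * X)%type).
apply: (@le_trans _ _ (\int[pi']_z (c z)%:E)%E).
  by apply: ereal_inf_lbound; exists pi'.
(* The allowed excess cost at [x]: [1 - v x] is the mass that [E] contributes after integration over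
   [P']. *)
pose k x := e / 2 + C * (1 - v x).
have k0 x : 0 <= k x.
  by have /andP[_ v1] := vP x; rewrite addr_ge0 ?mulr_ge0 ?subr_ge0// ltW.
have mv : measurable_fun setT (v : borel X -> R).
  by apply: measurable_sum => i; exact: measurable_funM.
have mk : measurable_fun setT (k : borel X -> R).
  apply: measurable_funD => //; apply: measurable_funM => //.
  exact: measurable_funB.
have mk1 : measurable_fun setT ((fun z => k z.1) : borel (X * X)%type -> R).
  exact: (measurableT_comp mk (@measurable_fst_borel X)).
apply: (@le_trans _ _ (\int[pi]_z ((c z)%:E + (k z.1)%:E))%E).
  apply: pi'E.
  - exact/measurable_EFinP.
  - by apply: emeasurable_funD; exact/measurable_EFinP.
  - by move=> w; rewrite lee_fin.
  move=> [x y] /=.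
  (* Where [D] is positive the new cost exceeds the old one by at most [e / 2]; under [E] it is
     estimated by [C] alone. *)
  apply: (@le_trans _ _ (\int[P']_x' ((c (x, y) + e / 2) * D x' x + C * E x' x)%:E)%E).
    have mx (F : X -> X -> R) : measurable_fun setT
        (fun z : borel X * borel X => F z.1 z.2) ->
        measurable_fun setT ((fun x' => F x' x) : borel X -> R).
      move=> mF; have mk' : measurable_fun setT
          ((fun x' => (x', x)) : borel X -> (borel X * borel X)%type).
        exact: measurable_fun_pair.
      exact: (measurableT_comp mF mk').
    apply: ge0_le_integral => //.
    - by move=> x' _; rewrite mule_ge0 ?lee_fin ?addr_ge0.
    - apply: emeasurable_funM; apply/measurable_EFinP.
        apply: (@continuous_borel_measurable R X (fun x' => c (x', y))) => x'.
        apply: (@continuous_comp _ _ _ (fun x' => (x', y)) c); last exact: cc.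
        by apply: cvg_pair => /=; [exact: cvg_id|exact: cvg_cst].
      by apply: measurable_funD; exact: mx.
    - apply/measurable_EFinP; apply: measurable_funD.
        by apply: measurable_funM => //; exact: mx.
      by apply: measurable_funM => //; exact: mx.
    - move=> x' _; rewrite -EFinM lee_fin mulrDr; apply: lerD; last first.
        by rewrite ler_wpM2r.
      rewrite /D /diag_density !mulr_sumr; apply: ler_sum => i _.
      have [->|fx'] := eqVneq (phi i x') 0; first by rewrite mulr0 mul0r !mulr0.
      have [->|fx] := eqVneq (phi i x) 0; first by rewrite !mulr0.
      rewrite !mulrA ler_wpM2r// ler_wpM2r// ler_wpM2r//.
      have : `|c (x', y) - c (x, y)| <= e / 2.
        apply: rP; have := dT x (z i) x'; rewrite (dC x (z i)).
        by have := phiz _ _ fx; have := phiz _ _ fx'; lra.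
      by rewrite ler_norml => /andP[_]; lra.
  (* Integration gives [(c (x, y) + e / 2) * v x + C * (1 - v x)], and [v x <= 1]. *)
  rewrite intDE lee_fin /k.
  have /andP[v0 v1] := vP x.
  by rewrite addrA lerD2r ler_piMr// addr_ge0// ltW.
rewrite ge0_integralD//; last 4 first.
- by move=> w _; rewrite lee_fin.
- exact/measurable_EFinP.
- by move=> w _; rewrite lee_fin.
- exact/measurable_EFinP.
rewrite leeD2l//.
rewrite (integral_coupling_fst (f := fun x => (k x)%:E) piPQ); last 2 first.
- exact/measurable_EFinP.
- by move=> x; rewrite lee_fin.
(* The mean of [v] under [P] is [s], so the mean of [k] is [e / 2 + C * (1 - s)]; the affine form
   lets [integral_partition_affine] compute it. *)
have kE x : k x = \sum_i - C * (t i * b i) * phi i x + (e / 2 + C).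
  have -> : \sum_i - C * (t i * b i) * phi i x = - C * v x.
    by rewrite /v mulr_sumr; apply: eq_bigr => i _; ring.
  by rewrite /k; ring.
under eq_integral do rewrite kE.
rewrite (integral_partition_affine mphi phi0 phi1) lee_fin.
have -> : \sum_i - C * (t i * b i) * \int[P]_x phi i x = - C * s.
  by rewrite mulr_sumr; apply: eq_bigr => i _; rewrite -/(a i); ring.
have Ceta : C * eta <= e / 4.
  have : eta <= e / (4 * C) by rewrite ge_min lexx orbT.
  by rewrite ler_pdivlMr ?mulr_gt0//; lra.
have Cdel : C * (n%:R * del) <= e / 4.
  have -> : C * (n%:R * del) = e / 4 * (n%:R / n.+1%:R).
    have : n.+1%:R != 0 :> R by rewrite pnatr_eq0.
    rewrite /del; move: (n.+1%:R : R) => m m_neq0.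
    by field; rewrite m_neq0 gt_eqF.
  by rewrite ler_piMr ?ler_pdivrMr ?mul1r ?ler_nat// divr_ge0// ltW.
have : C * (1 - s) <= C * (eta + n%:R * del) by rewrite ler_pM2l.
by move: Ceta Cdel; lra.
Qed.

Lemma transport_cost_bounds : exists C, forall P Q : bprob R X,
  (0 <= transport_cost c P Q <= C%:E)%E.
Proof.
have [C cC] : exists M, forall z, `|c z| <= M.
  exact: (compact_bounded_continuous compact_setTX cc).
exists C => P Q; apply/andP; split.
  apply: le_ereal_inf_tmp => _ [pi _ <-].
  by apply: integral_ge0 => z _; rewrite lee_fin.
have [pi piPQ] := couplings_nonempty mX cX P Q.
apply: (@le_trans _ _ (\int[pi]_z (c z)%:E)%E).
  by apply: ereal_inf_lbound; exists pi.
have mc : measurable_fun setT (c : borel (X * X)%type -> R).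
  exact: (@continuous_borel_measurable R (X * X)%type).
rewrite (EFin_Rintegral_bounded _ mc cC) lee_fin.
exact: le_trans (ler_norm _) (normr_Rintegral_le _ mc cC).
Qed.

Lemma transport_cost_fin_num (P Q : bprob R X) :
  transport_cost c P Q \is a fin_num.
Proof.
have [C /(_ P Q)/andP[c0' cC]] := transport_cost_bounds.
by rewrite ge0_fin_numE// (le_lt_trans cC)// ltry.
Qed.

Hypothesis csym : forall x y, c (x, y) = c (y, x).

(** Carries [transport_cost_perturb], which moves the first marginal, over to the second. *)
Lemma transport_costC (P Q : bprob R X) :
  transport_cost c P Q = transport_cost c Q P.
Proof.
suff le (P' Q' : bprob R X) :
    (transport_cost c P' Q' <= transport_cost c Q' P')%E.
  by apply/eqP; rewrite eq_le !le.
apply: le_ereal_inf_tmp => _ [pi pQP <-].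
have mc : measurable_fun setT (c : borel (X * X)%type -> R).
  exact: (@continuous_borel_measurable R (X * X)%type).
have [pi' pPQ ppE] := couplings_swap pQP mc c0.
apply: ereal_inf_lbound; exists pi' => //.
by rewrite ppE; apply: eq_integral => -[x y] _; rewrite csym.
Qed.

Lemma asymp_eq_transport_cost I (G : set_system I) {FG : Filter G}
    (mu mu' nu nu' : I -> bprob R X) :
  asymp_eq G mu mu' -> asymp_eq G nu nu' ->
  (fine (transport_cost c (mu i) (nu i)) -
   fine (transport_cost c (mu' i) (nu' i))) @[i --> G] --> (0 : R).
Proof.
move=> mm nn; apply/cvgrPdist_lt => e e0.
have e30 : 0 < e / 3 by rewrite divr_gt0.
have [n [phi [del [cphi del0 H]]]] := transport_cost_perturb e30.
have near_phi (m m' : I -> bprob R X) : asymp_eq G m m' ->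
    \forall i \near G, forall j,
      `|\int[m i]_x phi j x - \int[m' i]_x phi j x| <= del.
  move=> am; apply: filter_forall => j.
  have [M hM] := compact_bounded_continuous cX (cphi j).
  have /cvgrPdist_le/(_ _ del0) := am _ (cphi j) (bounded_of_le hM).
  by apply: filterS => i; rewrite sub0r normrN.
apply: filterS2 (near_phi _ _ mm) (near_phi _ _ nn) => i hm hn.
have fH (P P' Q : bprob R X) :
    (forall j, `|\int[P]_x phi j x - \int[P']_x phi j x| <= del) ->
    fine (transport_cost c P' Q) <= fine (transport_cost c P Q) + e / 3.
  move=> h; have := @H P P' Q h.
  rewrite -(fineK (transport_cost_fin_num P' Q)).
  by rewrite -(fineK (transport_cost_fin_num P Q)) -EFinD lee_fin.
(* First [mu] is exchanged for [mu'] beside [nu], then [nu] for [nu'] beside [mu'], each in both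
   directions; the total error is [2 * e / 3]. *)
have h1 := fH _ _ (nu i) hm.
have h2 := fH _ _ (nu i) (fun j => ltac:(rewrite distrC; exact: hm)).
have h3 := fH _ _ (mu' i) hn.
have h4 := fH _ _ (mu' i) (fun j => ltac:(rewrite distrC; exact: hn)).
rewrite !(transport_costC (nu _)) !(transport_costC (nu' _)) in h3 h4.
by rewrite sub0r normrN ltr_norml; apply/andP; split; lra.
Qed.

End transport_continuity.

(** * The state space *)

Lemma nset_compact (T : topologicalType) (A : set T) (A0 : A !=set0) :
  compact A -> compact [set: nset A0].
Proof.
move=> /compact_near_coveringP/near_covering_withinP cA.
apply/compact_near_coveringP => J F P FF cov.
(* Quantifying over proofs of membership extends a property of the subtype to all of [T], where
   compactness of [A] applies. *)
have : \near F, A `<=` (fun y => forall Ay : A y, P F (nset_of A0 Ay)).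
  apply: cA => y Ay.
  have [[B C] /= [[Z [[V oV VZ] Zy] ZB] FC] BC] := cov (nset_of A0 Ay) I.
  exists (V, C) => /=.
    split => //; apply: open_nbhs_nbhs; split=> //.
    by move: Zy; rewrite -VZ.
  move=> [y' i] /= [Vy' Ci] _ Ay'; apply: (BC (nset_of A0 Ay', i)); split => //.
  by apply: ZB; rewrite -VZ.
apply: filterS => i h x _.
have Ax : A (nval x) by exact: set_valP.
have -> : x = nset_of A0 Ax by exact: val_inj.
exact: h.
Qed.

Lemma PE_compact (R : realType) N : compact (PE R N).
Proof.
apply: finite_compact.
apply: (@sub_finite_set _ _ ((fun i : nat => i%:R / N%:R) @` `I_N.+1)).
  by move=> _ [i /andP[_ iN] ->]; exists i.
by apply: finite_image; exact: finite_II.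
Qed.

Section state_space.
Context (R : realType) (N d : nat) (N0 : (0 < N)%N).
Context (S : set 'cV[R]_d) (S0 : S !=set0).
Local Notation X := (state N0 S0).

(** An auxiliary distance, independent of [lambda]. It tends to zero as soon as each term does,
    which suits the coordinatewise definition of [attention]. *)
Definition state_dist (a b : X) : R :=
  `|nval a.1 - nval b.1| + \sum_(i < d) `|nval a.2 i 0 - nval b.2 i 0|.

Lemma continuous_state_coord1 : continuous (fun x : X => nval x.1 : R).
Proof.
move=> x; apply: (@continuous_comp _ _ _ (@fst _ _) (@nval _ _ (PE_nonempty R N0))).
  exact: cvg_fst.
exact: nval_continuous.
Qed.

Lemma continuous_state_coord2 i : continuous (fun x : X => nval x.2 i 0 : R).
Proof.
move=> x; apply: (@continuous_comp _ _ _ (@snd _ _)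
  (fun x : nset S0 => nval x i 0)); first exact: cvg_snd.
exact: nval_coord_continuous.
Qed.

Lemma state_compact : compact S -> compact [set: X].
Proof.
move=> cS; rewrite -setXTT; apply: compact_setX; apply: nset_compact => //.
exact: PE_compact.
Qed.

Lemma state_metrizes : metrizes state_dist.
Proof.
split.
- by move=> x; rewrite /state_dist subrr normr0 add0r big1// => i _; rewrite subrr normr0.
- move=> x y; rewrite /state_dist distrC; congr (_ + _).
  by apply: eq_bigr => i _; rewrite distrC.
- move=> x y z; rewrite /state_dist addrACA -big_split/=; apply: lerD.
    exact: ler_distD.
  by apply: ler_sum => i _; exact: ler_distD.
move=> x Z; split.
  case=> -[U1 U2] /= [[W1 [[V1 oV1 V1W1] W1x] W1U1] [W2 [[V2 oV2 V2W2] W2x] W2U2]] UZ.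
  have nV1 : nbhs (nval x.1) V1.
    by apply: open_nbhs_nbhs; split=> //; move: W1x; rewrite -V1W1.
  have nV2 : nbhs (nval x.2) V2.
    by apply: open_nbhs_nbhs; split=> //; move: W2x; rewrite -V2W2.
  move/nbhs_ballP : nV1 => [e1 /= e10 eV1].
  move/nbhs_ballP : nV2 => [e2 /= e20 eV2].
  exists (Num.min e1 e2); first by rewrite lt_min e10.
  move=> y; rewrite lt_min /state_dist => /andP[xy1 xy2]; apply: UZ; split=> /=.
    apply: W1U1; rewrite -V1W1; apply: eV1; rewrite /ball/=.
    by apply: le_lt_trans xy1; rewrite lerDl sumr_ge0.
  apply: W2U2; rewrite -V2W2; apply: eV2; split=> // i j.
  rewrite (ord1 j); apply: le_lt_trans xy2.
  rewrite (bigD1 i)//= addrCA lerDl addr_ge0// sumr_ge0//.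
move=> [e e0 xZ].
have cdist : state_dist x y @[y --> x] --> state_dist x x.
  apply: cvgD.
    apply: cvg_norm; apply: cvgB; first exact: cvg_cst.
    exact: continuous_state_coord1.
  have addc : continuous (fun x : R * R => x.1 + x.2) by exact: add_continuous.
  apply: (@cvg_big R 'I_d +%R 0 xpredT addc _ _ _
    (fun i (y : X) => `|nval x.2 i 0 - nval y.2 i 0|)
    (fun i => `|nval x.2 i 0 - nval x.2 i 0|) (nbhs_filter x)) => i _.
  apply: cvg_norm; apply: cvgB; first exact: cvg_cst.
  exact: continuous_state_coord2.
have dxx : state_dist x x = 0.
  by rewrite /state_dist subrr normr0 add0r big1// => i _; rewrite subrr normr0.
have /cvgrPdist_lt/(_ _ e0) := cdist.
apply: filterS => y; rewrite dxx sub0r normrN => h; apply: xZ.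
exact: le_lt_trans (ler_norm _) h.
Qed.

Lemma continuous_cost (lambda : R) :
  continuous (fun z : X * X => cost lambda z.1 z.2).
Proof.
have c1 (f : (X * X)%type -> X) : continuous f -> continuous (fun z => nval (f z).1 : R).
  move=> cf z; apply: (@continuous_comp _ _ _ f (fun x : X => nval x.1 : R)).
    exact: cf.
  exact: continuous_state_coord1.
have c2 (f : (X * X)%type -> X) i : continuous f ->
    continuous (fun z => nval (f z).2 i 0 : R).
  move=> cf z; apply: (@continuous_comp _ _ _ f (fun x : X => nval x.2 i 0 : R)).
    exact: cf.
  exact: continuous_state_coord2.
have cf : continuous (fst : X * X -> X) by move=> z; exact: cvg_fst.
have cs : continuous (snd : X * X -> X) by move=> z; exact: cvg_snd.
have cv i : continuous (fun z : X * X => (nval z.1.2 - nval z.2.2) i 0).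
  have -> : (fun z : X * X => (nval z.1.2 - nval z.2.2) i 0) =
      (fun z => nval z.1.2 i 0 - nval z.2.2 i 0).
    by apply/funext => z; rewrite !mxE.
  by move=> z; apply: cvgB; [exact: c2|exact: c2].
have -> : (fun z : X * X => cost lambda z.1 z.2) =
    (fun z => dotv (nval z.1.2 - nval z.2.2) (nval z.1.2 - nval z.2.2) +
      lambda * (`|nval z.1.1 - nval z.2.1| * `|nval z.1.1 - nval z.2.1|)).
  apply/funext => z; rewrite /cost /l2norm sqr_sqrtr//.
  by apply: sumr_ge0 => i _; rewrite -expr2 sqr_ge0.
move=> z; apply: cvgD.
  exact: (@continuous_dotv R (X * X)%type d
    (fun z => nval z.1.2 - nval z.2.2) (fun z => nval z.1.2 - nval z.2.2) cv cv z).
apply: cvgM; first exact: cvg_cst.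
by apply: cvgM; apply: cvg_norm; apply: cvgB; exact: c1.
Qed.

Lemma cost_ge0 (lambda : R) (a b : X) : 0 < lambda -> 0 <= cost lambda a b.
Proof. by move=> l0; rewrite addr_ge0 ?sqr_ge0// mulr_ge0 ?sqr_ge0// ltW. Qed.

Lemma costC (lambda : R) (a b : X) : cost lambda a b = cost lambda b a.
Proof.
rewrite /cost distrC; congr (_ + _); rewrite -opprB /l2norm /dotv.
by under eq_bigr do rewrite mxE mulrNN.
Qed.

End state_space.

(** * Continuity of the dynamics *)

Lemma cvg_sub_limit (R : realType) (I : Type) (G : set_system I) {FG : Filter G}
    (f : I -> R) (l : R) : f @ G --> l -> (f i - l) @[i --> G] --> (0 : R).
Proof. by move=> fl; rewrite -(subrr l); apply: cvgB fl _; exact: cvg_cst. Qed.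

(** [D] eventually exceeds [e / 2]. The difference of the quotients is [(D i)^-1] times [(n i - n'
    i) - n' i / D' i * (D i - D' i)], where [(D i)^-1 <= 2 / e] and [n' i / D' i] is at most [M / e]
    in absolute value. *)
Lemma cvg_div_sub0 (R : realType) (I : Type) (G : set_system I) {FG : Filter G}
    (n D n' D' : I -> R) (e M : R) : 0 < e ->
  (forall i, e <= D' i) -> (forall i, `|n' i| <= M) ->
  (n i - n' i) @[i --> G] --> (0 : R) -> (D i - D' i) @[i --> G] --> (0 : R) ->
  ((D i)^-1 * n i - (D' i)^-1 * n' i) @[i --> G] --> (0 : R).
Proof.
move=> e0 eD' n'M nn DD.
pose bound i := 2 / e * (`|n i - n' i| + M / e * `|D i - D' i|).
have bound0 : bound i @[i --> G] --> (0 : R).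
  have -> : 0 = 2 / e * (`|0 : R| + M / e * `|0 : R|) :> R.
    by rewrite normr0 mulr0 addr0 mulr0.
  apply: cvgM; first exact: cvg_cst.
  apply: cvgD; first exact: cvg_norm.
  by apply: cvgM; [exact: cvg_cst|exact: cvg_norm].
have e20 : 0 < e / 2 by rewrite divr_gt0.
apply/cvgrPdist_lt => r r0.
have /cvgrPdist_lt/(_ _ r0) := bound0.
have /cvgrPdist_lt/(_ _ e20) := DD.
apply: filterS2 => i; rewrite !sub0r !normrN => hD; apply: le_lt_trans.
apply: le_trans (ler_norm _); rewrite /bound.
have D'p : 0 < D' i := lt_le_trans e0 (eD' i).
have De : e / 2 <= D i.
  by move: hD; rewrite ltr_norml => /andP[? ?]; have := eD' i; lra.
have Dp : 0 < D i := lt_le_trans e20 De.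
have -> : (D i)^-1 * n i - (D' i)^-1 * n' i =
    (D i)^-1 * ((n i - n' i) - n' i / D' i * (D i - D' i)).
  by field; rewrite !gt_eqF.
rewrite normrM; apply: ler_pM => //.
  rewrite gtr0_norm ?invr_gt0// -[2 / e]invf_div lef_pV2 ?posrE//.
rewrite (le_trans (ler_normB _ _))// lerD2l normrM ler_wpM2r//.
rewrite normrM (gtr0_norm (x := (D' i)^-1)) ?invr_gt0//.
by apply: ler_pM; rewrite ?invr_ge0 ?(ltW D'p)// lef_pV2 ?posrE.
Qed.

(** * Kernels integrated against asymptotically equal measures *)

Section asymptotic_kernels.
Context (R : realType) (X : ptopologicalType) (dist : X -> X -> R).
Hypotheses (mX : metrizes dist) (cX : compact [set: X]).

Lemma asymp_eq_refl I (G : set_system I) {FG : Filter G} (mu : I -> bprob R X) :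
  asymp_eq G mu mu.
Proof. by move=> h _ _; under eq_fun do rewrite subrr; exact: cvg_cst. Qed.

Lemma asymp_eq_fst I J (G : set_system I) (H : set_system J) {FG : Filter G}
    {FH : Filter H} (mu nu : I -> bprob R X) :
  asymp_eq G mu nu ->
  asymp_eq (filter_prod G H) (fun p => mu p.1) (fun p => nu p.1).
Proof.
move=> mn h ch bh.
exact: (cvg_comp _ _ (@cvg_fst _ _ G H _) (mn h ch bh)).
Qed.

(** Measure and parameter move together: joint continuity of [k] at [(y0, x0)] supplies the local
    hypotheses of [asymp_eq_integral], and compactness bounds [k] at the fixed [y0]. *)
Lemma asymp_eq_kernel I (G : set_system I) {FG : Filter G} (Y : topologicalType)
    (mu nu : I -> bprob R X) (y : I -> Y) (y0 : Y) (k : Y * X -> R) :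
  asymp_eq G mu nu -> y @ G --> y0 -> continuous k ->
  (\int[mu i]_x k (y i, x) - \int[nu i]_x k (y0, x)) @[i --> G] --> (0 : R).
Proof.
move=> mn yy0 ck.
have ck1 y1 : continuous (fun x => k (y1, x)).
  move=> x; apply: (@continuous_comp _ _ _ (fun x => (y1, x)) k); last exact: ck.
  by apply: cvg_pair => /=; [exact: cvg_cst|exact: cvg_id].
have mk y1 : measurable_fun setT ((fun x => k (y1, x)) : borel X -> R).
  exact: continuous_borel_measurable.
have [M hM] := compact_bounded_continuous cX (@ck1 y0).
apply: (@asymp_eq_integral _ _ _ mX cX _ _ _ _ _ (fun i x => k (y i, x))
  (fun=> fun x => k (y0, x)) M) => //.
- by move=> i; exact: compact_bounded_continuous.
- move=> x0; apply: cvg_sub_limit.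
  apply: (@cvg_comp _ _ _ (fun p => (y p.1, p.2)) k _ (nbhs (y0, x0))); last exact: ck.
  apply: cvg_pair => /=; last exact: cvg_snd.
  exact: (cvg_comp _ _ (@cvg_fst _ _ G _ _) yy0).
- move=> x0; apply: cvg_sub_limit.
  apply: (@cvg_comp _ _ _ snd (fun x => k (y0, x)) _ (nbhs x0)); last exact: ck1.
  exact: cvg_snd.
Qed.

Lemma uniformly_continuous_sub0 I (G : set_system I) {FG : Filter G}
    (h : X -> R) (a b : I -> X) : continuous h ->
  (dist (a i) (b i)) @[i --> G] --> (0 : R) ->
  (h (a i) - h (b i)) @[i --> G] --> (0 : R).
Proof.
move=> ch ab; apply/cvgrPdist_lt => e e0.
(* Over a one-point index, [near_uniform] is uniform continuity of [h]. *)
have [] := @near_uniform _ _ _ mX cX unit (globally setT) _ (fun=> h) (fun=> h) _ _ _ e0.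
- move=> x0; apply: cvg_sub_limit.
  by apply: (@cvg_comp _ _ _ snd h _ (nbhs x0)); [exact: cvg_snd|exact: ch].
- move=> x0; apply: cvg_sub_limit.
  by apply: (@cvg_comp _ _ _ snd h _ (nbhs x0)); [exact: cvg_snd|exact: ch].
move=> r r0 /(_ tt Logic.I) hr.
have /cvgrPdist_lt/(_ _ r0) := ab.
apply: filterS => i; rewrite !sub0r !normrN => /(le_lt_trans (ler_norm _)).
exact: hr.
Qed.

End asymptotic_kernels.

Lemma continuous_fst_comp (Y A B : topologicalType) (f : Y -> A * B) :
  continuous f -> continuous (fun y => (f y).1).
Proof.
move=> cf y; apply: (@continuous_comp _ _ _ f fst); first exact: cf.
exact: cvg_fst.
Qed.

Lemma continuous_snd_comp (Y A B : topologicalType) (f : Y -> A * B) :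
  continuous f -> continuous (fun y => (f y).2).
Proof.
move=> cf y; apply: (@continuous_comp _ _ _ f snd); first exact: cf.
exact: cvg_snd.
Qed.

Lemma continuous_set_val_comp (Y T : topologicalType) (A : set T)
    (f : Y -> set_type A) :
  continuous f -> continuous (fun y => set_val (f y) : T).
Proof.
move=> cf y; apply: (@continuous_comp _ _ _ f (@set_val _ A)); first exact: cf.
exact: initial_continuous.
Qed.

Lemma continuous_mulmx_coord2 (R : realType) (Y : topologicalType) m n
    (A : Y -> 'M[R]_(m, n)) (x : Y -> 'cV[R]_n) :
  (forall i j, continuous (fun y => A y i j)) ->
  (forall i, continuous (fun y => x y i 0)) ->
  forall j, continuous (fun y => (A y *m x y) j 0).
Proof.
move=> cA cx j; have -> : (fun y => (A y *m x y) j 0) =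
    (fun y => dotv (\col_i A y j i) (x y)).
  by apply: funext => y; rewrite mxE; apply: eq_bigr => i _; rewrite mxE.
apply: continuous_dotv => // i.
by have -> : (fun y => (\col_i A y j i) i 0) = (fun y => A y j i)
  by apply: funext => y; rewrite mxE.
Qed.

Section dynamics.
Context (R : realType) (N d d1 d2 : nat) (N0 : (0 < N)%N) (beta : R).
Context (S : set 'cV[R]_d) (S0 : S !=set0).
Context (sigma : 'cV[R]_d1 -> 'cV[R]_d1) (UU : set (param R d d1 d2)).
Hypothesis sigma_lip : forall x y, l2norm (sigma x - sigma y) <= l2norm (x - y).
Hypothesis fX : token_map_stable N0 beta S0 sigma UU.
Hypothesis S_compact : compact S.
Local Notation X := (state N0 S0).
Local Notation XU := (X * set_type UU)%type.

Let mX : metrizes (@state_dist R N d N0 S S0) := state_metrizes N0 S0.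
Let cX : compact [set: X] := @state_compact R N d N0 S S0 S_compact.

Definition feedforward (y : XU) : 'cV[R]_d :=
  let: (W, A, b, _, _, _) := set_val y.2 in
  W *m sigma (A *m nval y.1.2 + b).

(** State, parameter and integration variable are arguments of a single continuous function, the
    form of kernel that [asymp_eq_kernel] takes. The integration variable is a whole state, so the
    measure is not replaced by its marginal. *)
Definition attention_weight (z : XU * X) : R :=
  let: (_, _, _, Q, K, _) := set_val z.1.2 in
  expR (beta * dotv (Q *m nval z.1.1.2) (K *m nval z.2.2)).

Definition attention_value (j : 'I_d) (z : XU * X) : R :=
  let: (_, _, _, _, _, V) := set_val z.1.2 in
  attention_weight z * (V *m nval z.2.2) j 0.

Section parameter_continuity.
Context (Y : topologicalType) (U : Y -> set_type UU).
Hypothesis cU : continuous U.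

Let cV : continuous (fun y => set_val (U y) : param R d d1 d2).
Proof.
exact: continuous_set_val_comp cU.
Qed.

Let coord m n (M : Y -> 'M[R]_(m, n)) i j :
  continuous M -> continuous (fun y => M y i j).
Proof.
move=> cM y; apply: (@continuous_comp _ _ _ M (fun M : 'M[R]_(m, n) => M i j)).
  exact: cM.
exact: coord_continuous.
Qed.

Lemma continuous_param :
  [/\ forall i j, continuous (fun y => (set_val (U y)).1.1.1.1.1 i j),
      forall i j, continuous (fun y => (set_val (U y)).1.1.1.1.2 i j) &
      forall i j, continuous (fun y => (set_val (U y)).1.1.1.2 i j)] /\
  [/\ forall i j, continuous (fun y => (set_val (U y)).1.1.2 i j),
      forall i j, continuous (fun y => (set_val (U y)).1.2 i j) &
      forall i j, continuous (fun y => (set_val (U y)).2 i j)].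
Proof.
have c1 := continuous_fst_comp cV.
have c2 := continuous_fst_comp c1.
have c3 := continuous_fst_comp c2.
have c4 := continuous_fst_comp c3.
split; split=> i j; apply: coord.
- exact: continuous_fst_comp c4.
- exact: continuous_snd_comp c4.
- exact: continuous_snd_comp c3.
- exact: continuous_snd_comp c2.
- exact: continuous_snd_comp c1.
- exact: continuous_snd_comp cV.
Qed.

End parameter_continuity.

Lemma continuous_feedforward j : continuous (fun y => feedforward y j 0).
Proof.
have [[cW cA cb] _] := @continuous_param XU snd (fun y => cvg_snd).
have cx i : continuous (fun y : XU => nval y.1.2 i 0 : R).
  move=> y; apply: (@continuous_comp XU X R fst (fun x : X => nval x.2 i 0)).
    exact: cvg_fst.
  exact: continuous_state_coord2.
(* Projections replace the destructuring of the parameter, since their continuity is available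
   separately for each component. *)
have -> : (fun y => feedforward y j 0) = (fun y : XU =>
    ((set_val y.2).1.1.1.1.1 *m sigma ((set_val y.2).1.1.1.1.2 *m nval y.1.2 +
      (set_val y.2).1.1.1.2)) j 0).
  by apply/funext => y; rewrite /feedforward; case: (set_val y.2) => -[[[[]]]].
apply: (@continuous_mulmx_coord2 R XU) => // i.
apply: (@lipschitz_coord_continuous R XU) => // l.
have -> : (fun y : XU => ((set_val y.2).1.1.1.1.2 *m nval y.1.2 +
      (set_val y.2).1.1.1.2) l 0) =
    (fun y => ((set_val y.2).1.1.1.1.2 *m nval y.1.2) l 0 +
      (set_val y.2).1.1.1.2 l 0) by apply/funext => y; rewrite mxE.
move=> y; apply: cvgD; last exact: cb.
exact: (@continuous_mulmx_coord2 R XU).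
Qed.

Let cz1 i : continuous (fun z : XU * X => nval z.1.1.2 i 0 : R).
Proof.
move=> z; apply: (@continuous_comp _ _ _ (fun z : XU * X => z.1.1)
  (fun x : X => nval x.2 i 0 : R)); last exact: continuous_state_coord2.
exact: (continuous_fst_comp (continuous_fst_comp (fun z => cvg_id))).
Qed.

Let cz2 i : continuous (fun z : XU * X => nval z.2.2 i 0 : R).
Proof.
move=> z; apply: (@continuous_comp _ _ _ snd
  (fun x : X => nval x.2 i 0 : R)); last exact: continuous_state_coord2.
exact: cvg_snd.
Qed.

Let cU : continuous (fun z : XU * X => z.1.2).
Proof. exact: (continuous_snd_comp (continuous_fst_comp (fun z => cvg_id))). Qed.

Lemma continuous_attention_weight : continuous attention_weight.
Proof.
have [_ [cQ cK _]] := @continuous_param _ _ cU.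
have -> : attention_weight = (fun z : XU * X =>
    expR (beta * dotv ((set_val z.1.2).1.1.2 *m nval z.1.1.2)
      ((set_val z.1.2).1.2 *m nval z.2.2))).
  by apply/funext => z; rewrite /attention_weight; case: (set_val z.1.2) => -[[[[]]]].
move=> z; apply: (@continuous_comp _ _ _ (fun z : XU * X =>
  beta * dotv ((set_val z.1.2).1.1.2 *m nval z.1.1.2)
    ((set_val z.1.2).1.2 *m nval z.2.2)) (@expR R)); last exact: continuous_expR.
apply: cvgM; first exact: cvg_cst.
apply: (@continuous_dotv R (XU * X)%type) => i;
  exact: (@continuous_mulmx_coord2 R (XU * X)%type).
Qed.

Lemma continuous_attention_value j : continuous (attention_value j).
Proof.
have [_ [_ _ cV]] := @continuous_param _ _ cU.
have -> : attention_value j = (fun z : XU * X =>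
    attention_weight z * ((set_val z.1.2).2 *m nval z.2.2) j 0).
  by apply/funext => z; rewrite /attention_value; case: (set_val z.1.2) => -[[[[]]]].
move=> z; apply: cvgM; first exact: continuous_attention_weight.
exact: (@continuous_mulmx_coord2 R (XU * X)%type).
Qed.

(** Turns the integrals of [attention] into integrals against [mu] itself, to which [asymp_eq]
    speaks directly. *)
Lemma Rintegral_marginalS (mu : bprob R X) (f : nset S0 -> R) : continuous f ->
  \int[marginalS mu]_z f z = \int[mu]_z f z.2.
Proof.
move=> cf; have cX2 := nset_compact (A0 := S0) S_compact.
have [M hM] := compact_bounded_continuous cX2 cf.
have mf : measurable_fun setT (f : borel (nset S0) -> R).
  exact: continuous_borel_measurable.
have mf2 : measurable_fun setT ((fun z : X => f z.2) : borel X -> R).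
  exact: (measurableT_comp mf (@measurable_snd_state R N d N0 S S0)).
rewrite /Rintegral integral_distribution//; first exact/measurable_EFinP.
exact: (bounded_integrable _ mf2 (fun x => hM x.2)).
Qed.

Lemma transition_coord (x : X) (U : set_type UU) (mu : bprob R X) j :
  nval (transition fX x U mu).2 j 0 = feedforward (x, U) j 0 +
    (\int[mu]_z attention_weight ((x, U), z))^-1 *
    \int[mu]_z attention_value j ((x, U), z).
Proof.
have -> : nval (transition fX x U mu).2 =
  token_map beta sigma (nval x.2) (set_val U) (marginalS mu) by [].
rewrite /attention_value /attention_weight /feedforward /=.
case: (set_val U) => -[[[[W A] b] Q] K] V /=.
rewrite mxE /attention [X in _ + X]mxE [X in _ * X]mxE.
have cK (B : 'M[R]_(d2, d)) i : continuous (fun z : nset S0 => (B *m nval z) i 0).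
  by apply: continuous_mulmx_coord => l; exact: nval_coord_continuous.
have cw : continuous (fun z : nset S0 =>
    expR (beta * dotv (Q *m nval x.2) (K *m nval z))).
  move=> z; apply: (@continuous_comp _ _ _ (fun z : nset S0 =>
    beta * dotv (Q *m nval x.2) (K *m nval z)) (@expR R)).
    apply: (@cvgM R (nset S0) (nbhs z) _ (fun=> beta)); first exact: cvg_cst.
    apply: (@continuous_dotv R (nset S0) d2 (fun=> Q *m nval x.2)
      (fun z => K *m nval z)) => i; last exact: cK.
    exact: (@cst_continuous (nset S0) R ((Q *m nval x.2) i 0)).
  exact: continuous_expR.
rewrite (Rintegral_marginalS _ cw) (Rintegral_marginalS mu (f := fun z =>
  expR (beta * dotv (Q *m nval x.2) (K *m nval z)) * (V *m nval z) j 0))//.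
have cV : continuous (fun z : nset S0 => (V *m nval z) j 0).
  by apply: continuous_mulmx_coord => l; exact: nval_coord_continuous.
move=> z; exact: (@cvgM R (nset S0) (nbhs z) (nbhs_filter z) _ _ _ _ (@cw z) (@cV z)).
Qed.

Lemma attention_weight_gt0 z : 0 < attention_weight z.
Proof.
by rewrite /attention_weight; case: (set_val z.1.2) => -[[[[]]]] *; exact: expR_gt0.
Qed.

(** Point and parameter converge while the measures only stay close, so [nu i] remains in the
    comparison term. The feedforward part is continuous, and the attention quotient is handled by
    [cvg_div_sub0]. *)
Lemma transition_asymp I (G : set_system I) {FG : Filter G}
    (mu nu : I -> bprob R X) (x : I -> X) (U : I -> set_type UU) (x0 : X) (U0 : set_type UU) :
  asymp_eq G mu nu -> x @ G --> x0 -> U @ G --> U0 ->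
  state_dist (transition fX (x i) (U i) (mu i)) (transition fX x0 U0 (nu i))
    @[i --> G] --> (0 : R).
Proof.
move=> mn xx0 UU0.
have yy0 : (fun i => (x i, U i)) @ G --> nbhs (x0, U0) by exact: cvg_pair xx0 UU0.
have s0 : 0 = `|0 : R| + \sum_(j < d) `|0 : R|.
  by rewrite normr0 big1// addr0.
rewrite [X in _ --> X]s0; apply: cvgD.
  apply: cvg_norm; apply: (cvg_sub_limit (l := nval x0.1)).
  exact: (cvg_comp _ _ xx0 (@continuous_state_coord1 _ _ _ _ _ _ x0)).
have addc : continuous (fun x : R * R => x.1 + x.2) by exact: add_continuous.
apply: (@cvg_big R 'I_d +%R 0 xpredT addc _ _ _
  (fun j i => `|nval (transition fX (x i) (U i) (mu i)).2 j 0 -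
     nval (transition fX x0 U0 (nu i)).2 j 0|) (fun=> `|0|) FG) => j _.
apply: cvg_norm.
under eq_fun do rewrite !transition_coord opprD addrACA.
rewrite -(addr0 (0 : R)); apply: cvgD.
  apply: cvg_sub_limit.
  exact: (cvg_comp _ _ yy0 (@continuous_feedforward j (x0, U0))).
have c0 (k : (XU * X)%type -> R) : continuous k -> continuous (fun z => k ((x0, U0), z)).
  move=> ck z.
  apply: (@continuous_comp X (XU * X)%type R (fun z => ((x0, U0), z)) k); last exact: ck.
  have cst0 : (fun=> (x0, U0)) @ nbhs z --> nbhs (x0, U0) by exact: cvg_cst.
  exact: cvg_pair cst0 cvg_id.
have cw := c0 _ continuous_attention_weight.
have cv := c0 _ (@continuous_attention_value j).
have [Mw hMw] := compact_bounded_continuous cX cw.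
have [Mv hMv] := compact_bounded_continuous cX cv.
have mw : measurable_fun setT
    ((fun z => attention_weight ((x0, U0), z)) : borel X -> R).
  exact: continuous_borel_measurable.
have mv : measurable_fun setT
    ((fun z => attention_value j ((x0, U0), z)) : borel X -> R).
  exact: continuous_borel_measurable.
(* The minimum of the limiting weight over the compact space is positive and bounds the denominators
   below, uniformly in the measures [nu i]. *)
have [z0 _ z0min] := @compact_EVT_min X R (fun z => attention_weight ((x0, U0), z))
  setT (ex_intro _ point Logic.I) cX (continuous_subspaceT cw).
apply: (@cvg_div_sub0 _ _ _ _ _ _ _ _ (attention_weight ((x0, U0), z0)) Mv).
- exact: attention_weight_gt0.
- move=> i.
  have <- : \int[nu i]_z (cst (attention_weight ((x0, U0), z0)) z) =
      attention_weight ((x0, U0), z0).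
    exact: Rintegral_cst_prob.
  apply: le_Rintegral => //.
  + exact: (@bounded_integrable _ _ _ _ _ `|attention_weight ((x0, U0), z0)|).
  + exact: (bounded_integrable _ mw hMw).
  + by move=> z _; apply: z0min; rewrite inE.
- by move=> i; exact: normr_Rintegral_le.
- exact: (asymp_eq_kernel mX cX mn yy0 (@continuous_attention_value j)).
- exact: (asymp_eq_kernel mX cX mn yy0 continuous_attention_weight).
Qed.

(** The integral of [h] after a step is the integral of [h] composed with the transition, an
    integrand that itself depends on the measure; hence the index-dependent integrands in
    [asymp_eq_integral]. *)
Lemma asymp_eq_step I (G : set_system I) {FG : Filter G}
    (mu nu : I -> bprob R X) (U : I -> set_type UU) (U0 : set_type UU) :
  asymp_eq G mu nu -> U @ G --> U0 ->
  asymp_eq G (fun i => step sigma_lip fX (mu i) (U i))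
    (fun i => step sigma_lip fX (nu i) U0).
Proof.
move=> mn UU0 h ch [B [_ hB]].
have hM x : `|h x| <= B + 1 by apply: (hB (B + 1)) => //; rewrite ltrDl.
have mh : measurable_fun setT (h : borel X -> R).
  exact: continuous_borel_measurable.
have mht V m : measurable_fun setT
    ((fun x => h (transition fX x V m)) : borel X -> R).
  exact: (measurableT_comp mh (transition_measurable sigma_lip fX V m)).
have stepE m V : \int[step sigma_lip fX m V]_x h x =
    \int[m]_x h (transition fX x V m).
  rewrite /Rintegral integral_distribution//; first exact/measurable_EFinP.
  exact: (bounded_integrable _ (mht V m) (fun x => hM _)).
under eq_fun do rewrite !stepE.
apply: (@asymp_eq_integral _ _ _ mX cX _ _ _ _ _
  (fun i x => h (transition fX x (U i) (mu i)))
  (fun i x => h (transition fX x U0 (nu i))) (B + 1)) => //.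
- by move=> i; exists (B + 1).
- move=> x0.
  apply: (uniformly_continuous_sub0 mX cX (a := fun p => transition fX p.2 (U p.1) (mu p.1))
    (b := fun p => transition fX x0 U0 (nu p.1)) ch).
  apply: (@transition_asymp _ _ _ (fun p => mu p.1) (fun p => nu p.1) snd
    (fun p => U p.1)).
  + exact: asymp_eq_fst.
  + exact: cvg_snd.
  + exact: (cvg_comp _ _ (@cvg_fst _ _ G _ _) UU0).
- move=> x0.
  apply: (uniformly_continuous_sub0 mX cX (a := fun p => transition fX p.2 U0 (nu p.1))
    (b := fun p => transition fX x0 U0 (nu p.1)) ch).
  apply: (@transition_asymp _ _ _ (fun p => nu p.1) (fun p => nu p.1) snd (fun=> U0)).
  + exact: asymp_eq_refl.
  + exact: cvg_snd.
  + exact: cvg_cst.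
Qed.

(** Induction on the list of times, generalized over both families because each step replaces
    them. *)
Lemma asymp_eq_flow T I (G : set_system I) {FG : Filter G}
    (mu nu : I -> bprob R X) (u : I -> {ptws 'I_T -> set_type UU})
    (u0 : {ptws 'I_T -> set_type UU}) :
  asymp_eq G mu nu -> (forall t, (u i t) @[i --> G] --> u0 t) ->
  asymp_eq G (fun i => flow sigma_lip fX (mu i) (u i))
    (fun i => flow sigma_lip fX (nu i) u0).
Proof.
rewrite /flow => mn uu0; elim: (enum 'I_T) mu nu mn => [//|t s IH] mu nu mn /=.
by apply: IH; exact: asymp_eq_step.
Qed.

End dynamics.

(** * The value function *)

(** The topology of [bprob] is initial for all these integrals together, and a single one is a
    coordinate projection of that map. *)
Lemma continuous_bprob_integral (R : realType) (T : ptopologicalType)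
    (h : T -> R) : continuous h -> [bounded h x | x in [set: T]] ->
  continuous (fun mu : bprob R T => \int[mu]_x h x).
Proof.
move=> ch bh mu; pose hb : bcont R T := exist _ h (conj ch bh).
apply: (@continuous_comp _ _ _ (@bcont_integral R T)
  (fun f : {ptws bcont R T -> R} => f hb)); first exact: initial_continuous.
exact: (@proj_continuous {classic (bcont R T)} (fun=> R) hb).
Qed.

(** [value] is extended real; its finiteness makes continuity of [fine] of it a statement about the
    value function itself. *)
Theorem lemma12 (R : realType) (N d d1 d2 T : nat)
    (N0 : (0 < N)%N) (d_gt0 : (0 < d)%N) (d1_gt0 : (0 < d1)%N)
    (d2_gt0 : (0 < d2)%N) (T_gt0 : (0 < T)%N)
    (beta lambda : R) (beta_gt0 : 0 < beta) (lambda_gt0 : 0 < lambda)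
    (S : set 'cV[R]_d) (S0 : S !=set0)
    (sigma : 'cV[R]_d1 -> 'cV[R]_d1)
    (sigma_lip : forall x y, l2norm (sigma x - sigma y) <= l2norm (x - y))
    (UU : set (param R d d1 d2)) (UU0 : UU !=set0)
    (fX : token_map_stable N0 beta S0 sigma UU)
    (S_compact : compact S) (UU_compact : compact UU) :
  (forall (P : bprob R (bprob R (state N0 S0) * bprob R (state N0 S0))%type)
          (u : {ptws 'I_T -> set_type UU}),
     value lambda sigma_lip fX P u \is a fin_num) /\
  continuous
    (fun z : bprob R (bprob R (state N0 S0) * bprob R (state N0 S0))%type *
             {ptws 'I_T -> set_type UU} =>
       fine (value lambda sigma_lip fX z.1 z.2)).
Proof.
set X := state N0 S0; set Y := (bprob R X * bprob R X)%type.
have mX : metrizes (@state_dist R N d N0 S S0) := state_metrizes N0 S0.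
have cX : compact [set: X] := @state_compact R N d N0 S S0 S_compact.
pose c (z : X * X) : R := cost lambda z.1 z.2.
have cc : continuous c by exact: continuous_cost.
have c0 z : 0 <= c z by exact: cost_ge0.
have csym x y : c (x, y) = c (y, x) by exact: costC.
pose F (z : Y) (u : {ptws 'I_T -> set_type UU}) : R :=
  fine (transport_cost c (flow sigma_lip fX z.1 u) z.2).
have [C HC] := transport_cost_bounds mX cX cc c0.
have FC u z : `|F z u| <= C.
  have fin := transport_cost_fin_num mX cX cc c0 (flow sigma_lip fX z.1 u) z.2.
  have := HC (flow sigma_lip fX z.1 u) z.2.
  rewrite -(fineK fin) !lee_fin -/(F z u) => /andP[F0 F1].
  by rewrite ger0_norm.
have asymp_F I (G : set_system I) (FG : Filter G) (z z' : I -> Y)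
    (u : I -> {ptws 'I_T -> set_type UU}) (u0 : {ptws 'I_T -> set_type UU}) :
    asymp_eq G (fun i => (z i).1) (fun i => (z' i).1) ->
    asymp_eq G (fun i => (z i).2) (fun i => (z' i).2) -> u @ G --> u0 ->
    (F (z i) (u i) - F (z' i) u0) @[i --> G] --> (0 : R).
  move=> h1 h2 uu0.
  apply: (asymp_eq_transport_cost mX cX cc c0 csym _ h2).
  apply: (asymp_eq_flow sigma_lip fX S_compact h1) => t.
  exact: (cvg_comp _ _ uu0 (@proj_continuous _ (fun=> set_type UU) t u0)).
have cF u : continuous (F ^~ u : Y -> R).
  move=> z0; apply/cvgrPdist_lt => e e0.
  have : (F z u - F z0 u) @[z --> z0] --> (0 : R).
    (* The moving pair is compared with the constant pair [z0]; the two are asymptotically equal by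
       weak convergence of each coordinate. *)
    apply: (@asymp_F _ _ _ id (fun=> z0) (fun=> u)); last exact: cvg_cst.
      move=> h ch bh; apply: cvg_sub_limit.
      apply: (@continuous_comp _ _ _ fst (fun m : bprob R X => \int[m]_x h x) z0).
        exact: cvg_fst.
      exact: continuous_bprob_integral.
    move=> h ch bh; apply: cvg_sub_limit.
    apply: (@continuous_comp _ _ _ snd (fun m : bprob R X => \int[m]_x h x) z0).
      exact: cvg_snd.
    exact: continuous_bprob_integral.
  move=> /cvgrPdist_lt/(_ _ e0); apply: filterS => z.
  by rewrite sub0r opprB.
have mF u : measurable_fun setT (F ^~ u : borel Y -> R).
  exact: continuous_borel_measurable.
have valueE P u : value lambda sigma_lip fX P u = (\int[P]_z F z u)%:E.
  rewrite -(EFin_Rintegral_bounded P (mF u) (FC u)) /value.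
  apply: eq_integral => z _.
  have fin := transport_cost_fin_num mX cX cc c0 (flow sigma_lip fX z.1 u) z.2.
  (* The square undoes the root in [W2] because the transport cost is nonnegative. *)
  rewrite /F fineK// -[LHS]/(sqrte (transport_cost c (flow sigma_lip fX z.1 u) z.2) ^+ 2)%E.
  by rewrite sqr_sqrte//; have /andP[] := HC (flow sigma_lip fX z.1 u) z.2.
split; first by move=> P u; rewrite valueE.
rewrite (_ : (fun z => _) = (fun z : bprob R Y * {ptws 'I_T -> set_type UU} =>
  \int[z.1]_y F y z.2)); last first.
  by apply/funext => z; rewrite valueE.
move=> [P0 u0]; apply/cvgrPdist_lt => e e0.
have e20 : 0 < e / 2 by rewrite divr_gt0.
(* The filter leaves the pair of measures arbitrary and moves only the parameter. Both sides contain
   the same measures, so [asymp_eq_refl] suffices, and the limit is uniform in the pair. *)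
have unif : (F p.1 p.2 - F p.1 u0)
    @[p --> filter_prod (globally [set: Y]) (nbhs u0)] --> (0 : R).
  apply: (@asymp_F (Y * {ptws 'I_T -> set_type UU})%type
    (filter_prod (globally [set: Y]) (nbhs u0)) _ fst fst snd u0);
    last exact: cvg_snd.
    exact: asymp_eq_refl.
  exact: asymp_eq_refl.
have /cvgrPdist_lt/(_ _ e20)[[A B]/= [AT Bu0] AB] := unif.
have cP0 := @continuous_bprob_integral R Y _ (@cF u0) (bounded_of_le (FC u0)) P0.
have /cvgrPdist_lt/(_ _ e20) nP0 := cP0.
(* A weak neighborhood of [P0] given by the one test function [F ^~ u0], times the parameter
   neighborhood from [unif]. *)
exists ([set P : bprob R Y | `|\int[P0]_z F z u0 - \int[P]_z F z u0| < e / 2], B) => //=.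
move=> [P u] [/= hP Bu].
have iF v : P.-integrable setT (EFin \o F ^~ v).
  exact: (bounded_integrable P (mF v) (FC v)).
have : `|\int[P]_z F z u - \int[P]_z F z u0| <= e / 2.
  rewrite -RintegralB//; apply: normr_Rintegral_le.
    exact: measurable_funB.
  move=> z; have := AB (z, u) (conj (AT z Logic.I) Bu).
  by rewrite /= sub0r normrN => /ltW.
(* The comparison passes through the integral of [F ^~ u0] against [P]: weak closeness of [P] to
   [P0] on one side, the uniform estimate on the other. *)
rewrite [X in _ < X]splitr distrC => huu0.
by rewrite (le_lt_trans (ler_distD (\int[P]_z F z u0) _ _))// ltr_leD.
Qed.
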